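(* Let $1\le\delta\le 16$ and let $S\subset\mathbb{P}^3$ be a complex quartic surface with $\delta$ nodes (that is, $S\in\mathcal{V}_\delta$). Then the set $\Delta:=\operatorname{Sing}S$ of singular points of $S$ imposes independent conditions on the linear system $|\mathcal{O}_{\mathbb{P}^3}(4)|$: $$\dim H^0(\mathbb{P}^3,\mathcal{I}_{\mathbb{P}^3,\Delta}(4))=35-\delta.$$
   Context: Work over $\mathbb{C}$. A node is an ordinary double point (an $A_1$ surface singularity). $\mathcal{V}_\delta$ denotes the locally closed subset of the projective space of quartic surfaces in $\mathbb{P}^3$ parametrizing quartic surfaces with $\delta$ nodes, i.e. surfaces whose singular locus consists of exactly $\delta$ points, all of them nodes. $\mathcal{I}_{\mathbb{P}^3,\Delta}$ is the ideal sheaf of the reduced finite set $\Delta\subset\mathbb{P}^3$. Note $\dim H^0(\mathbb{P}^3,\mathcal{O}_{\mathbb{P}^3}(4))=35$. A quartic surface has at most $16$ nodes. *)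

(* Defs.v *)
From HB Require Import structures.
From mathcomp Require Import all_boot all_order all_algebra.
From mathcomp Require Import finmap.
From mathcomp Require Import boolp classical_sets functions cardinality reals.
From mathcomp Require Import complex.
From mathcomp Require Import mpoly.

Set Implicit Arguments.
Unset Strict Implicit.
Unset Printing Implicit Defensive.

Import GRing.Theory.
Local Open Scope ring_scope.
Local Open Scope classical_set_scope.

Section ProjectiveSpace.
Variables (K : fieldType) (V : vectType K).

(* The points of P(V) are the one-dimensional subspaces of V. *)
Record projspace := ProjPoint { pline : {vspace V}; _ : \dim pline == 1%N }.

HB.instance Definition _ := [isSub for pline].
HB.instance Definition _ := [Choice of projspace by <:].

(* Homogeneous coordinates: a chosen nonzero vector of the line. *)
Definition hcoord (p : projspace) : V := vpick (pline p).

Lemma hcoord_neq0 p : hcoord p != 0.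
Proof. by rewrite vpick0 -dimv_eq0; case: p => L /= /eqP ->. Qed.

Lemma pline_hcoord p : pline p = <[hcoord p]>%VS.
Proof.
apply/esym/eqP; rewrite eqEdim -memvE memv_pick dim_vline hcoord_neq0.
by case: p => L /= /eqP ->.
Qed.

End ProjectiveSpace.

Notation "''PP' ( V )" := (projspace V)
  (at level 8, format "''PP' ( V )") : type_scope.

Section AffineHypersurface.
Variables (K : fieldType) (n : nat).
Implicit Types (f : {mpoly K[n]}) (a : 'I_n -> K).

Definition aff_singular f a : Prop :=
  f.@[a] = 0 /\ forall k, (f^`M(k)).@[a] = 0.

Definition hessian f a : 'M[K]_n := \matrix_(j, k) (f^`M(j)^`M(k)).@[a].

(* Ordinary double point: f vanishes to order two at a and its tangent cone,
   the quadric given by half of the Hessian, is nondegenerate. *)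
Definition aff_node f a : Prop := aff_singular f a /\ hessian f a \in unitmx.

End AffineHypersurface.

Section Surfaces.
Variable K : fieldType.

(* H^0(P^3, O(d)) *)
Notation forms d := (dhomog 4 K d).
Notation P3 := 'PP('rV[K]_4).

Section Singularities.
Variable d : nat.
Implicit Types (S : 'PP(forms d)) (p : P3).

Definition equation S : {mpoly K[4]} := hcoord S.

(* The chart x_i <> 0 of P^3, identified with the affine space K^3 by setting
   x_i = 1; its coordinates are indexed along lift i. *)
Definition in_chart (i : 'I_4) p : bool := hcoord p 0 i != 0.

Definition chart_coord (i : 'I_4) p : 'I_3 -> K :=
  fun k => hcoord p 0 (lift i k) / hcoord p 0 i.

Definition dehomog (i : 'I_4) (F : {mpoly K[4]}) : {mpoly K[3]} :=
  F \mPo [tuple if unlift i j is Some k then 'X_k else 1 | j < 4].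

Definition Sing S : set P3 :=
  [set p | exists2 i, in_chart i p &
    aff_singular (dehomog i (equation S)) (chart_coord i p)].

Definition nodes S : set P3 :=
  [set p | exists2 i, in_chart i p &
    aff_node (dehomog i (equation S)) (chart_coord i p)].

End Singularities.

(* Points of |O(4)|. *)
Definition quartic_surface := 'PP(forms 4).

(* The locus V_delta of quartic surfaces with delta nodes. *)
Definition nodal_quartics (delta : nat) : set quartic_surface :=
  [set S | (Sing S #= `I_delta)%card /\ Sing S `<=` nodes S].

Definition eval_form d (p : P3) (G : forms d) : K^o :=
  (G : {mpoly K[4]}).@[hcoord p 0].

Fact eval_form_is_linear d p : linear (@eval_form d p).
Proof. by move=> c G H; rewrite /eval_form /= mevalD mevalZ. Qed.
HB.instance Definition _ d p :=
  GRing.isLinear.Build K (forms d) K^o _ (@eval_form d p)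
    (@eval_form_is_linear d p).

(* H^0(P^3, I_Delta(d)) for the reduced subscheme with finite support Delta;
   fset_set returns the empty set on an infinite argument. *)
Definition H0_ideal (Delta : set P3) (d : nat) : {vspace forms d} :=
  (\bigcap_(p <- fset_set Delta) lker (linfun (@eval_form d p)))%VS.

Lemma mem_H0_ideal (Delta : set P3) d (G : forms d) : finite_set Delta ->
  G \in H0_ideal Delta d <->
  forall p (v : 'rV[K]_4), Delta p -> v \in pline p ->
    (G : {mpoly K[4]}).@[v 0] = 0.
Proof.
move=> finD; rewrite /H0_ideal; split=> [GD p v Dp|GD].
  rewrite pline_hcoord => /vlineP[c ->].
  have /allP /(_ p) : all (fun p => G \in lker (linfun (@eval_form d p)))
      (fset_set Delta).
    apply/allP => q qD; move: GD; rewrite (big_rem q qD) /= memv_cap.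
    by case/andP.
  rewrite in_fset_set // inE => /(_ Dp).
  rewrite memv_ker lfunE /= /eval_form => /eqP G0.
  have /dhomogP hG := dhomog_is_dhomog G.
  have -> : (G : {mpoly K[4]}).@[(c *: hcoord p)%R 0] =
            c ^+ d * (G : {mpoly K[4]}).@[hcoord p 0].
    rewrite !mevalE mulr_sumr; apply: eq_big_seq => m mG.
    rewrite mulrCA; congr (_ * _).
    under eq_bigr do rewrite mxE exprMn.
    by rewrite big_split /= prodrXr -mdegE (hG _ mG).
  by rewrite [X in _ * X](G0 : _ = 0) mulr0.
have: all (fun p => G \in lker (linfun (@eval_form d p))) (fset_set Delta).
  apply/allP => p; rewrite in_fset_set // inE => Dp.
  by rewrite memv_ker lfunE /= /eval_form (GD p) ?memv_pick.
elim: (enum_fset _) => [|p s IH]; first by rewrite big_nil memvf.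
by rewrite big_cons memv_cap /= => /andP[-> /IH].
Qed.

End Surfaces.

(* Main.v *)
From HB Require Import structures.
Require Import Defs.
From mathcomp Require Import all_boot all_algebra.
From mathcomp Require Import perm finmap.
From mathcomp Require Import reals complex.
From mathcomp Require Import boolp classical_sets functions cardinality.
From mathcomp Require Import mpoly ring zify.

(** Let F be the equation of S and suppose that sum_k c_k G(p_k) = 0 for all
quartic forms G, the p_k being the nodes. The hyperplanes tangent to S at some
smooth point lie in a hypersurface of the dual space, so there is a plane l = 0
which is tangent to S nowhere and avoids the nodes; scale the p_k to l(p_k) = 1.
The three cubics f_i that are the derivatives of F along directions of that
plane vanish at the nodes, have independent gradients there, and have no common
zero on l = 0.

Write f_i(x) - f_i(y) and l(x) - l(y) as combinations of the x_j - y_j, and let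
D(x, y), of degree 6, be the determinant of the 4 x 4 matrix of coefficients
(the Bezoutian). As the relation c kills the forms of degree at most 4,
sum_k c_k D(x, l(x) p_k) = l^5 h with h a linear form, and h(p_k) is a nonzero
multiple of c_k because p_k is a node. By Cramer's rule, modulo (f_1, f_2, f_3),
the quintics times h lie in the span of the at most 16 sextics D(x, l(x) p_k).

This is impossible in degree 6: (f_1, f_2, f_3) has dimension at most 58,
whereas h and two general combinations of the f_i form a regular sequence, so
that they generate a space of dimension at least 75 > 58 + 16. *)

Set Implicit Arguments.
Unset Strict Implicit.
Unset Printing Implicit Defensive.
Import GRing.Theory Num.Theory.
Local Open Scope ring_scope.

(** * Homogeneous polynomials: substitution, scaling and derivatives *)

Section Poly.
Variables (K : comNzRingType).

Lemma msupp_dhomog_sum n d (p : {mpoly K[n]}) (m : 'X_{1..n}) :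
  p \is d.-homog -> m \in msupp p -> (\sum_i m i)%N = d.
Proof. by move=> /dhomogP hp mp; rewrite -mdegE; exact: hp. Qed.

Lemma comp_dhomog (n k d e : nat) (p : {mpoly K[n]}) (t : n.-tuple {mpoly K[k]}) :
  p \is d.-homog -> (forall i, tnth t i \is e.-homog) -> p \mPo t \is (e * d).-homog.
Proof.
move=> hp ht; rewrite comp_mpolyE big_seq rpred_sum // => m mp.
rewrite rpredZ // -(msupp_dhomog_sum hp mp) big_distrr /=.
elim/big_rec2: _ => [|i a q _ hq]; first exact: dhomog1.
by rewrite dhomogM ?dhomogMn.
Qed.

Lemma comp_mpoly_scale n k d (p : {mpoly K[n]}) (l : {mpoly K[k]}) (v : 'I_n -> K) :
  p \is d.-homog ->
  p \mPo [tuple l * (v i)%:MP | i < n] = l ^+ d * (p.@[v])%:MP.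
Proof.
move=> hp; rewrite comp_mpolyE mevalE raddf_sum mulr_sumr.
apply: eq_big_seq => m mp; rewrite /= mpolyCM -(msupp_dhomog_sum hp mp) -prodrXr.
rewrite -mul_mpolyC mulrCA; congr (_ * _).
rewrite rmorph_prod -big_split /=; apply: eq_bigr => i _.
by rewrite tnth_mktuple exprMn rmorphXn.
Qed.

Lemma meval_scale n d (p : {mpoly K[n]}) (c : K) (v : 'I_n -> K) :
  p \is d.-homog -> p.@[fun i => c * v i] = c ^+ d * p.@[v].
Proof.
move=> hp; rewrite !mevalE mulr_sumr.
apply: eq_big_seq => m mp; rewrite mulrCA; congr (_ * _).
rewrite -(msupp_dhomog_sum hp mp) -prodrXr -big_split /=.
by apply: eq_bigr => i _; rewrite exprMn.
Qed.

Lemma mderiv_comp n k (p : {mpoly K[n]}) (t : n.-tuple {mpoly K[k]}) j :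
  (p \mPo t)^`M(j) = \sum_i (p^`M(i) \mPo t) * (tnth t i)^`M(j).
Proof.
(* [D] obeys the Leibniz rule twisted by substitution, as the left-hand side does, so it suffices to
   compare the two on constants and variables. *)
pose D q := \sum_i (q^`M(i) \mPo t) * (tnth t i)^`M(j).
have DC c : D c%:MP = 0.
  by rewrite /D big1 // => i _; rewrite mderivC comp_mpoly0 mul0r.
have DD q r : D (q + r) = D q + D r.
  rewrite /D -big_split; apply: eq_bigr => i _ /=.
  by rewrite mderivD comp_mpolyD mulrDl.
have DM q r : D (q * r) = D q * (r \mPo t) + (q \mPo t) * D r.
  rewrite /D mulr_suml mulr_sumr -big_split; apply: eq_bigr => i _ /=.
  rewrite mderivM comp_mpolyD !rmorphM /= mulrDl; congr (_ + _).
    by rewrite mulrAC.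
  by rewrite mulrA.
have DX i : D 'X_i = (tnth t i)^`M(j).
  rewrite /D (bigD1 i) //= mderivX big1 ?addr0 => [|l li].
    rewrite mnm1E eqxx scale1r.
    have -> : (U_(i) - U_(i) = 0 :> 'X_{1..n})%MM by apply/mnmP=> l; rewrite !mnmE subnn.
    by rewrite mpolyX0 rmorph1 mul1r.
  by rewrite mderivX mnm1E eq_sym (negPf li) scale0r comp_mpoly0 mul0r.
have cX i : 'X_i \mPo t = tnth t i by rewrite comp_mpolyXU (tnth_nth 0).
rewrite -/(D p).
elim/mpolyind: p => [|c m p _ _ IH].
  by rewrite comp_mpoly0 -[0 in RHS]mpolyC0 DC mderiv0.
rewrite comp_mpolyD mderivD DD IH; congr (_ + _).
rewrite -mul_mpolyC rmorphM /= mderivM DM DC comp_mpolyC mderivC !mul0r !add0r.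
congr (_ * _); rewrite mpolyXE_id.
elim/big_rec: _ => [|i q _ IHq]; first by rewrite rmorph1 -mpolyC1 DC mderivC.
rewrite rmorphM /= mderivM DM IHq rmorphXn /= cX; congr (_ * _ + _).
elim: (m i) => [|e IHe]; first by rewrite !expr0 -mpolyC1 DC mderivC.
by rewrite !exprS mderivM DM DX IHe rmorphXn /= cX.
Qed.

Lemma mnm_addUK n (m : 'X_{1..n}) i : (0 < m i)%N -> (U_(i) + (m - U_(i)))%MM = m.
Proof.
move=> mi; rewrite addmC submK //.
by apply/mnm_lepP => l; rewrite mnm1E; case: eqP => // <-.
Qed.

Lemma euler n d (p : {mpoly K[n]}) :
  p \is d.-homog -> \sum_i 'X_i * p^`M(i) = p *+ d.
Proof.
move=> hp; rewrite [p in RHS]mpolyE -sumrMnl.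
transitivity (\sum_i \sum_(m <- msupp p) 'X_i * (p@_m *: 'X_[m])^`M(i)).
  by apply: eq_bigr => i _; rewrite {1}[p]mpolyE linear_sum mulr_sumr.
rewrite exchange_big /=; apply: eq_big_seq => m mp.
rewrite -[in RHS](msupp_dhomog_sum hp mp) -sumrMnr; apply: eq_bigr => i _.
rewrite mderivZ mderivX -!scalerAr.
case: (posnP (m i)) => [->|mi]; first by rewrite mulr0n scale0r scaler0.
by rewrite -mpolyXD mnm_addUK // scaler_nat scalerMnr.
Qed.

Lemma mderiv_dhomog n d (p : {mpoly K[n]}) i :
  p \is d.+1.-homog -> p^`M(i) \is d.-homog.
Proof.
move=> hp; rewrite [p]mpolyE linear_sum big_seq rpred_sum // => m mp /=.
rewrite mderivZ mderivX rpredZ //.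
case: (posnP (m i)) => [->|mi]; first by rewrite scale0r rpred0.
rewrite rpredZ // dhomogX; apply/eqP/succn_inj.
move/dhomogP: hp => /(_ m mp) /= <-.
by rewrite -[in RHS](mnm_addUK mi) mdegD mdeg1 add1n.
Qed.

End Poly.

(** * Difference quotients *)

Section DoublePoints.
Variables (K : comNzRingType) (n : nat).

(** Polynomials in n + n variables are read as functions of a pair of points (x, y); [spec s t]
    below substitutes [s] for x and [t] for y. *)
Definition xvars : n.-tuple {mpoly K[n + n]} := [tuple 'X_(lshift n i) | i < n].
Definition yvars : n.-tuple {mpoly K[n + n]} := [tuple 'X_(rshift n i) | i < n].

Definition spec k (s t : n.-tuple {mpoly K[k]}) : (n + n).-tuple {mpoly K[k]} :=
  [tuple match fintype.split i with inl j => tnth s j | inr j => tnth t j end | i < n + n].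

Lemma tnth_spec_l k (s t : n.-tuple {mpoly K[k]}) i : tnth (spec s t) (lshift n i) = tnth s i.
Proof. by rewrite tnth_mktuple (unsplitK (inl _)). Qed.

Lemma tnth_spec_r k (s t : n.-tuple {mpoly K[k]}) i : tnth (spec s t) (rshift n i) = tnth t i.
Proof. by rewrite tnth_mktuple (unsplitK (inr _)). Qed.

Lemma comp_comp k l (p : {mpoly K[n]}) (s : n.-tuple {mpoly K[k]}) (t : k.-tuple {mpoly K[l]}) :
  (p \mPo s) \mPo t = p \mPo [tuple tnth s i \mPo t | i < n].
Proof.
rewrite ![p \mPo _]comp_mpolyE raddf_sum; apply: eq_bigr => m _ /=.
rewrite comp_mpolyZ rmorph_prod; congr (_ *: _); apply: eq_bigr => i _ /=.
by rewrite rmorphXn tnth_mktuple.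
Qed.

Lemma comp_xvars k (p : {mpoly K[n]}) (s t : n.-tuple {mpoly K[k]}) :
  (p \mPo xvars) \mPo spec s t = p \mPo s.
Proof.
rewrite comp_comp; congr (_ \mPo _); apply: eq_from_tnth => i.
by rewrite !tnth_mktuple comp_mpolyXU -tnth_nth tnth_spec_l.
Qed.

Lemma comp_yvars k (p : {mpoly K[n]}) (s t : n.-tuple {mpoly K[k]}) :
  (p \mPo yvars) \mPo spec s t = p \mPo t.
Proof.
rewrite comp_comp; congr (_ \mPo _); apply: eq_from_tnth => i.
by rewrite !tnth_mktuple comp_mpolyXU -tnth_nth tnth_spec_r.
Qed.

Definition diag (v : 'I_n -> K) (i : 'I_(n + n)) : K :=
  match fintype.split i with inl j => v j | inr j => v j end.

Lemma diag_l v i : diag v (lshift n i) = v i.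
Proof. by rewrite /diag (unsplitK (inl _)). Qed.

Lemma diag_r v i : diag v (rshift n i) = v i.
Proof. by rewrite /diag (unsplitK (inr _)). Qed.

Lemma diff_quotient d (p : {mpoly K[n]}) :
  p \is d.-homog -> exists D : 'I_n -> {mpoly K[n + n]},
    (forall i, D i \is d.-1.-homog) /\
    (p \mPo xvars) - (p \mPo yvars) = \sum_i D i * ('X_(lshift n i) - 'X_(rshift n i)).
Proof.
have cX i : 'X_i \mPo xvars = 'X_(lshift n i) :> {mpoly K[n + n]}.
  by rewrite comp_mpolyXU -tnth_nth tnth_mktuple.
have cY i : 'X_i \mPo yvars = 'X_(rshift n i) :> {mpoly K[n + n]}.
  by rewrite comp_mpolyXU -tnth_nth tnth_mktuple.
have hX e (q : {mpoly K[n]}) : q \is e.-homog -> q \mPo xvars \is e.-homog.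
  move=> hq; rewrite -[e]mul1n; apply: comp_dhomog => // i.
  by rewrite tnth_mktuple dhomogX /= mdeg1.
(* In degree 0 the quotients have to be zero, not merely of degree [0.-1 = 0], because the induction
   step multiplies them by a variable. *)
have mono e (m : 'X_{1..n}) : mdeg m = e ->
    exists D : 'I_n -> {mpoly K[n + n]},
      (forall i, if e is e'.+1 then D i \is e'.-homog else D i == 0) /\
      ('X_[m] \mPo xvars) - ('X_[m] \mPo yvars) = \sum_i D i * ('X_(lshift n i) - 'X_(rshift n i)).
  elim: e m => [|e IH] m.
    move=> /eqP; rewrite mdeg_eq0 => /eqP ->.
    exists (fun=> 0); split=> [i //|].
    by rewrite mpolyX0 !rmorph1 subrr big1 // => i _; rewrite mul0r.
  move=> em; have [j mj] : exists j, (0 < m j)%N.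
    apply/existsP; apply: contra_eqT em; rewrite negb_exists => /forallP m0.
    by rewrite mdegE big1 // => i _; apply/eqP; rewrite -leqn0 leqNgt.
  have def_m := esym (mnm_addUK mj).
  have dm' : mdeg (m - U_(j))%MM = e.
    by move: em; rewrite {1}def_m mdegD mdeg1 add1n => -[].
  have [D [hD eD]] := IH _ dm'.
  (* With m = m' + U_j, this is x_j x^m' - y_j y^m' = y_j (x^m' - y^m') + (x_j - y_j) x^m'. *)
  exists (fun i => 'X_(rshift n j) * D i
     + (i == j)%:R *: ('X_[(m - U_(j))] \mPo xvars)); split=> [i|].
    apply: rpredD; last by rewrite rpredZ // hX // dhomogX /= dm'.
    case: e {IH em dm'} hD {eD} => [|e] /(_ i); first by move/eqP => ->; rewrite mulr0 rpred0.
    by move=> hD; rewrite -[e.+1]add1n dhomogM // dhomogX /= mdeg1.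
  rewrite def_m mpolyXD !rmorphM /= cX cY -def_m.
  under eq_bigr do rewrite mulrDl -mulrA.
  rewrite big_split /= -mulr_sumr -eD (bigD1 j) //= eqxx scale1r big1 => [|i /negPf ->].
    rewrite addr0; set x := 'X_(lshift n j); set y := 'X_(rshift n j).
    rewrite mulrBr [_ * (x - y)]mulrC mulrBl addrC addrA subrK //.
  by rewrite scale0r mul0r.
move=> /dhomogP hp.
have -> : (p \mPo xvars) - (p \mPo yvars) =
    \sum_(m <- msupp p) p@_m *: (('X_[m] \mPo xvars) - ('X_[m] \mPo yvars)).
  rewrite [p \mPo xvars]comp_mpolyEX [p \mPo yvars]comp_mpolyEX -sumrB.
  by apply: eq_bigr => m _; rewrite scalerBr.
have : {subset msupp p <= msupp p} by [].
elim: {-2}(msupp p) => [|m s IH] sp.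
  exists (fun=> 0); split=> [i|]; first exact: rpred0.
  by rewrite big_nil big1 // => i _; rewrite mul0r.
have [|D [hD eD]] := IH; first by move=> m' ms; apply: sp; rewrite inE ms orbT.
have /mono [D' [hD' eD']] := hp _ (sp m (mem_head _ _)).
exists (fun i => p@_m *: D' i + D i); split=> [i|].
  apply: rpredD => //; rewrite rpredZ //.
  by case: (d) (hD' i) => //= /eqP ->; exact: rpred0.
rewrite big_cons eD eD' scaler_sumr -big_split /=.
by apply: eq_bigr => i _; rewrite mulrDl scalerAl.
Qed.
(** The difference quotients at y = t(x). For a linear projection [t] this puts p - p(t) in the
    ideal of the image of [t]. *)
Lemma diff_comp d (p : {mpoly K[n]}) (t : n.-tuple {mpoly K[n]}) :
  p \is d.-homog -> (forall i, tnth t i \is 1.-homog) ->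
  exists D : 'I_n -> {mpoly K[n]}, (forall i, D i \is d.-1.-homog) /\
    p - (p \mPo t) = \sum_i D i * ('X_i - tnth t i).
Proof.
move=> hp ht; have [D [hD eD]] := diff_quotient hp.
set s := spec [tuple 'X_i | i < n] t.
have hs i : tnth s i \is 1.-homog.
  by rewrite tnth_mktuple; case: fintype.split => j //; rewrite tnth_mktuple dhomogX /= mdeg1.
exists (fun i => D i \mPo s); split=> [i|].
  by rewrite -[d.-1]mul1n; apply: comp_dhomog.
rewrite -{1}[p]comp_mpoly_id -(comp_xvars p _ t) -{1}(comp_yvars p [tuple 'X_i | i < n] t).
rewrite -comp_mpolyB eD (raddf_sum (comp_mpoly s)); apply: eq_bigr => i _ /=.
rewrite rmorphM /= comp_mpolyB !comp_mpolyXU -!tnth_nth tnth_spec_l tnth_spec_r.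
by rewrite tnth_mktuple.
Qed.

(** Differentiate the identity along x_j, then set y = x: a term in which some D_i is differentiated
    keeps the factor x_i - y_i and vanishes. *)
Lemma diff_quotient_diag (p : {mpoly K[n]}) (D : 'I_n -> {mpoly K[n + n]}) v j :
  (p \mPo xvars) - (p \mPo yvars) = \sum_i D i * ('X_(lshift n i) - 'X_(rshift n i)) ->
  (D j).@[diag v] = (p^`M(j)).@[v].
Proof.
have dX (i k : 'I_(n + n)) : ('X_i : {mpoly K[n + n]})^`M(k) = (i == k)%:R.
  rewrite mderivX mnm1E; case: eqP => [->|_]; last by rewrite scale0r.
  rewrite scale1r (_ : (_ - _)%MM = 0%MM) ?mpolyX0 //.
  by apply/mnmP => l; rewrite !mnmE subnn.
move=> /(congr1 (mderiv (lshift n j))) /(congr1 (meval (diag v))).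
have -> : (((p \mPo xvars) - (p \mPo yvars))^`M(lshift n j)).@[diag v] = (p^`M(j)).@[v].
  rewrite mderivB mevalB !mderiv_comp [X in _ - X.@[_]]big1 => [|i _]; last first.
    by rewrite tnth_mktuple dX eq_rlshift mulr0.
  rewrite meval0 subr0 (bigD1 j) //= tnth_mktuple dX eqxx mulr1 big1 ?addr0 => [|i ij].
    by rewrite comp_mpoly_meval; apply: meval_eq => i; rewrite tnth_mktuple mevalXU diag_l.
  by rewrite tnth_mktuple dX (inj_eq (@lshift_inj _ _)) (negPf ij) mulr0.
move=> ->; rewrite (raddf_sum (mderiv _)) (raddf_sum (meval _)) /=.
rewrite (bigD1 j) //= big1 ?addr0 => [|i ij].
  rewrite mderivM mevalD !mevalM mevalB !mevalXU diag_l diag_r subrr mulr0 add0r.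
  by rewrite mderivB !dX eqxx eq_rlshift subr0 meval1 mulr1.
rewrite mderivM mevalD !mevalM mevalB !mevalXU diag_l diag_r subrr mulr0 add0r.
by rewrite mderivB !dX (inj_eq (@lshift_inj _ _)) (negPf ij) eq_rlshift subr0 meval0 mulr0.
Qed.

End DoublePoints.

(** * Restriction to a line *)

Section Infinite.
Variable K : numFieldType.

(** In characteristic zero the integers below [size q] are distinct, and more numerous than the
    roots of [q]. *)
Lemma poly_neq0_horner (q : {poly K}) : q != 0 -> exists x, q.[x] != 0.
Proof.
move=> q0; apply: contrapT => /forallNP qx.
suff: (size [seq i%:R : K | i <- iota 0 (size q)] < size q)%N by rewrite size_map size_iota ltnn.
apply: max_poly_roots => //.
  by apply/allP => x _; apply/rootP/eqP/negPn/negP/qx.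
by rewrite map_inj_uniq ?iota_uniq // => i j /eqP; rewrite eqr_nat => /eqP.
Qed.

Lemma meval_muni n (p : {mpoly K[n.+1]}) (v : 'I_n.+1 -> K) :
  (map_poly (meval (fun i => v (widen_ord (leqnSn n) i))) (muni p)).[v ord_max] = p.@[v].
Proof.
rewrite muniE mevalE raddf_sum horner_sum; apply: eq_bigr => m _ /=.
rewrite map_polyZ map_polyXn hornerZ hornerXn /= mevalZ mevalX -mulrA; congr (_ * _).
by rewrite big_ord_recr /=; congr (_ * _); apply: eq_bigr => i _; rewrite mnmE.
Qed.

Lemma muni_eq0 n (p : {mpoly K[n.+1]}) : muni p = 0 -> p = 0.
Proof.
move=> p0; apply/mpolyP => m; rewrite mcoeff0.
have /(congr1 (fun q : {poly _} => q`_(m ord_max)@_[multinom m (widen_ord (leqnSn n) i) | i < n])) := p0.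
rewrite coef0 mcoeff0 muniE coef_sum raddf_sum /= => <-.
case mp : (m \in msupp p); last first.
  rewrite memN_msupp_eq0 ?mp // big_seq big1 // => m' m'p.
  rewrite coefZ coefXn; case: eqP => [e|_]; last by rewrite mulr0 mcoeff0.
  rewrite mulr1 mcoeffZ mcoeffX; case: eqP => [e'|_]; last by rewrite mulr0.
  suff mm' : m' = m by rewrite -mm' m'p in mp.
  apply/mnmP => i; case: (unliftP ord_max i) => [j ->|-> //].
  move/mnmP/(_ j): e'; rewrite !mnmE.
  by rewrite (_ : widen_ord _ j = lift ord_max j) //; apply/val_inj; rewrite /= /bump leqNgt ltn_ord.
rewrite (bigD1_seq m) ?msupp_uniq //= coefZ coefXn eqxx mulr1 mcoeffZ mcoeffX eqxx mulr1.
rewrite big1 ?addr0 // => m' nm.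
rewrite coefZ coefXn; case: eqP => [e|_]; last by rewrite mulr0 mcoeff0.
rewrite mulr1 mcoeffZ mcoeffX; case: eqP => [e'|_]; last by rewrite mulr0.
case/eqP: nm.
apply/mnmP => i; case: (unliftP ord_max i) => [j ->|-> //].
move/mnmP/(_ j): e'; rewrite !mnmE.
by rewrite (_ : widen_ord _ j = lift ord_max j) //; apply/val_inj; rewrite /= /bump leqNgt ltn_ord.
Qed.

(** Induction on the number of variables: the leading coefficient in the last variable is nonzero at
    some point, and specializing there leaves a nonzero univariate polynomial. *)
Lemma mpoly_neq0_meval n (p : {mpoly K[n]}) : p != 0 -> exists v, p.@[v] != 0.
Proof.
elim: n p => [|n IH] p p0.
  exists (fun=> 0); apply: contraNneq p0; by rewrite [p]nvar0_mpolyC mevalC => ->.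
have : muni p != 0 by apply: contraNneq p0 => /muni_eq0 ->.
rewrite -lead_coef_eq0 => /IH [v hv].
have [|x hx] := @poly_neq0_horner (map_poly (meval v) (muni p)).
    apply: contraNneq hv => /(congr1 (fun q : {poly K} => q`_(size (muni p)).-1)).
  by rewrite coef_map coef0 lead_coefE => ->.
pose v' i := if unlift ord_max i is Some j then v j else x.
exists v'; rewrite -meval_muni {2}/v' unlift_none.
rewrite (_ : map_poly _ _ = map_poly (meval v) (muni p)) //.
apply/polyP => k; rewrite !coef_map; apply: meval_eq => i; rewrite /v'.
rewrite (_ : widen_ord _ i = lift ord_max i) ?liftK //.
by apply/val_inj; rewrite /= /bump leqNgt ltn_ord.
Qed.

Lemma mpoly_eq_meval n (p q : {mpoly K[n]}) : (forall v, p.@[v] = q.@[v]) -> p = q.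
Proof.
move=> pq; apply/eqP; rewrite -subr_eq0; apply: contraT => /mpoly_neq0_meval [v].
by rewrite mevalB pq subrr eqxx.
Qed.

End Infinite.

Section Line.
Variables (K : numFieldType) (n : nat) (e e' : 'I_n -> K).

(** The projective line through [e] and [e'] is parametrized by e + X e', which misses [e']; for a
    form of degree d the value at [e'] is the coefficient of X^d. *)
Definition line_restr : {mpoly K[n]} -> {poly K} :=
  mmap polyC (fun i => (e i)%:P + (e' i)%:P * 'X).

HB.instance Definition _ := GRing.RMorphism.copy line_restr line_restr.

Lemma line_restrZ c p : line_restr (c *: p) = c *: line_restr p.
Proof. by rewrite /line_restr mmapZ mul_polyC. Qed.

Lemma line_restrX i : line_restr 'X_i = (e i)%:P + (e' i)%:P * 'X.
Proof. by rewrite /line_restr mmapX mmap1U. Qed.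

Lemma horner_line_restr p t : (line_restr p).[t] = p.@[fun i => e i + t * e' i].
Proof.
rewrite /line_restr /mmap mevalE horner_sum; apply: eq_bigr => m _.
rewrite hornerCM; congr (_ * _); rewrite /mmap1 horner_prod; apply: eq_bigr => i _.
by rewrite horner_exp !hornerE mulrC.
Qed.

(** Here [k] is a formal degree: [c] may be zero, as happens for a form vanishing at the point at
    infinity. *)
Definition top_coef k (q : {poly K}) c := (size q <= k.+1)%N /\ q`_k = c.

Lemma top_coefM k k' q q' c c' :
  top_coef k q c -> top_coef k' q' c' -> top_coef (k + k') (q * q') (c * c').
Proof.
move=> [sq qk] [sq' qk']; split.
  apply: leq_trans (size_polyMleq _ _) _; rewrite -subn1 leq_subLR add1n.
  by apply: leq_trans (leq_add sq sq') _; rewrite addSn addnS.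
have kk : (k < (k + k').+1)%N by rewrite ltnS leq_addr.
rewrite coefM (bigD1 (Ordinal kk)) //= addKn qk qk' big1 ?addr0 // => i.
rewrite -val_eqE /= => ik; case: (ltngtP i k) ik => // [ik|ki] _.
  rewrite (nth_default _ (n := (k + k' - i)%N)) ?mulr0 //; apply: leq_trans sq' _.
  by rewrite ltn_subRL ltn_add2r.
by rewrite nth_default ?mul0r //; apply: leq_trans sq _.
Qed.

Lemma line_restr_top d p : p \is d.-homog -> top_coef d (line_restr p) p.@[e'].
Proof.
move=> hp; rewrite /line_restr /mmap mevalE big_seq [in X in top_coef _ _ X]big_seq.
elim/big_rec2: _ => [|m c q mp [sq qd]]; first by split; rewrite ?size_poly0 ?coef0.
have [sm md] : top_coef d (mmap1 (fun i => (e i)%:P + (e' i)%:P * 'X) m) (\prod_i e' i ^+ m i).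
  rewrite -(msupp_dhomog_sum hp mp) /mmap1.
  elim/big_rec3: _ => [|i k c' q' _ IH]; first by split; rewrite ?size_poly1 ?coef1.
  apply: top_coefM => {IH} //; elim: (m i) => [|a IH].
    by rewrite !expr0; split; rewrite ?size_poly1 ?coef1.
  rewrite !exprS -[a.+1]add1n; apply: top_coefM => //; split.
    apply: leq_trans (size_polyD _ _) _; rewrite geq_max mulrC size_polyC.
    by rewrite (leq_trans (leq_b1 _)) //= -['X]expr1 (leq_trans (size_polyMleq _ _)) // size_polyXn size_polyC; case: (_ != 0).
  by rewrite coefD coefC coefCM coefX mulr1 add0r.
split; last by rewrite coefD coefCM md qd.
apply: leq_trans (size_polyD _ _) _; rewrite geq_max sq andbT.
by rewrite mul_polyC (leq_trans (size_scale_leq _ _)).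
Qed.

Lemma line_restr_eq0 d p s t : p \is d.-homog -> line_restr p = 0 ->
  p.@[fun i => s * e i + t * e' i] = 0.
Proof.
move=> hp p0; have [s0|s0] := eqVneq s 0.
  have [_] := line_restr_top hp; rewrite p0 coef0 => /esym pe'.
  rewrite (@meval_eq _ _ _ (fun i => t * e' i)) ?(meval_scale _ _ hp) ?pe' ?mulr0 //.
  by move=> i; rewrite s0 mul0r add0r.
rewrite (@meval_eq _ _ _ (fun i => s * (e i + t / s * e' i))); last first.
  by move=> i; rewrite mulrDr mulrA mulrCA divff ?mulr1.
by rewrite (meval_scale _ _ hp) -horner_line_restr p0 horner0 mulr0.
Qed.
End Line.

Section Closed.
Variable K : numClosedFieldType.

(** Some f_i is nonzero at [e'], hence has exact degree d on the line. At each of its finitely many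
    roots another f_k is nonzero, so a combination with coefficients x^j avoids all these roots for
    a suitable x. *)
Lemma line_coprime_combination n (e e' : 'I_n -> K) d m (f : 'I_m -> {mpoly K[n]}) :
  (forall i, f i \is d.-homog) ->
  (forall s t, (s != 0) || (t != 0) ->
     exists i, (f i).@[fun j => s * e j + t * e' j] != 0) ->
  exists (i : 'I_m) (b : 'I_m -> K),
    size (line_restr e e' (f i)) = d.+1 /\
    coprimep (line_restr e e' (f i)) (line_restr e e' (\sum_j b j *: f j)).
Proof.
move=> hf nz; have [|i fi] := nz 0 1; first by rewrite oner_eq0 orbT.
set q := line_restr e e' (f i).
have [sq qd] := line_restr_top e e' (hf i).
have {}fi : q`_d != 0.
  rewrite qd (@meval_eq _ _ _ (fun j => 0 * e j + 1 * e' j)) //.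
  by move=> j; rewrite mul0r add0r mul1r.
have {}sq : size q = d.+1.
  by apply/eqP; rewrite eqn_leq sq ltnNge; apply: contra fi => h; rewrite nth_default.
have q0 : q != 0 by rewrite -size_poly_gt0 sq.
have [rs def_q] := closed_field_poly_normal q.
(* As a polynomial in x, [P r] is the value of sum_j x^j f_j at the point r of the line. *)
pose P r : {poly K} := \poly_(j < m) (if insub j is Some k then (f k).@[fun j => 1 * e j + r * e' j] else 0).
have P0 r : P r != 0.
  have [|k fk] := nz 1 r; first by rewrite oner_eq0.
  apply: contraNneq fk => /(congr1 (fun p : {poly K} => p`_k)).
  by rewrite coef0 /P coef_poly ltn_ord valK => ->.
have [|x hx] := @poly_neq0_horner _ (\prod_(r <- rs) P r).
  by rewrite prodf_seq_neq0; apply/allP => r _; exact: P0.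
exists i, (fun j : 'I_m => x ^+ j); split=> //.
apply/Pdiv.ClosedField.coprimepP => r; rewrite -/q def_q rootZ ?lead_coef_eq0 // root_prod_XsubC => rrs.
apply: contraNN hx; rewrite /root horner_prod horner_line_restr => /eqP h0.
rewrite (big_rem r) //= (_ : (P r).[x] = 0) ?mul0r //.
rewrite -h0 horner_poly raddf_sum; apply: eq_bigr => j _.
rewrite valK /= mevalZ mulrC; congr (_ * _); apply: meval_eq => l.
by rewrite mul1r.
Qed.
End Closed.

(** * Regular sequences in low degree *)

Section LinForm.
Variables (K : comNzRingType) (n : nat).

Definition lform (a : 'I_n -> K) : {mpoly K[n]} := \sum_i a i *: 'X_i.

Lemma lform_dhomog a : lform a \is 1.-homog.
Proof. by apply: rpred_sum => i _; rewrite rpredZ // dhomogX /= mdeg1. Qed.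

Lemma meval_lform a v : (lform a).@[v] = \sum_i a i * v i.
Proof. by rewrite raddf_sum; apply: eq_bigr => i _; rewrite /= mevalZ mevalXU. Qed.

Lemma comp_lform k a (t : n.-tuple {mpoly K[k]}) :
  lform a \mPo t = \sum_i a i *: tnth t i.
Proof.
by rewrite raddf_sum; apply: eq_bigr => i _; rewrite /= comp_mpolyZ comp_mpolyXU -tnth_nth.
Qed.

Lemma dhomog0_mpolyC (p : {mpoly K[n]}) : p \is 0.-homog -> exists c, p = c%:MP.
Proof.
move=> hp; exists p@_0; apply/mpolyP => m; rewrite mcoeffC.
case: (eqVneq 0%MM m) => [<-|m0]; first by rewrite mulr1.
by rewrite mulr0 (dhomog_nemf_coeff hp) //= mdeg_eq0 eq_sym.
Qed.

Lemma dhomog1_lform (h : {mpoly K[n]}) : h \is 1.-homog -> exists a, h = lform a.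
Proof.
move=> hh; have c0 i : {c | h^`M(i) = c%:MP}.
  by apply: cid; apply: dhomog0_mpolyC; apply: mderiv_dhomog.
exists (fun i => projT1 (c0 i)); rewrite -[LHS](euler hh).
by apply: eq_bigr => i _; case: (c0 i) => c /= ->; rewrite mulrC mul_mpolyC.
Qed.

End LinForm.
Section Regular.
Variables (K : numClosedFieldType) (n : nat).
(* K^n = <u> + <w> + <e, e'>, where h and l are the coordinates along u and w. *)
Variables (h l u w e e' : 'I_n -> K).
Local Notation ev a v := (\sum_i a i * v i).
Hypotheses (hu : ev h u = 1) (he : ev h e = 0) (he' : ev h e' = 0).
Hypotheses (lu : ev l u = 0) (lw : ev l w = 1).
Hypothesis basis : forall v, exists s t, forall i,
  v i = ev h v * u i + ev l v * w i + (s * e i + t * e' i).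

(** Composition with [pi] is restriction to h = 0, projecting along [u]; composition with [sg] is
    restriction to the span of [e] and [e']. A form killed by [pi] is zero modulo h. *)
Let pi := [tuple 'X_i - u i *: lform h | i < n].
Let sg := [tuple 'X_i - (u i *: lform h + w i *: lform l) | i < n].
Local Notation L := (line_restr e e').

Let pi1 i : tnth pi i \is 1.-homog.
Proof. by rewrite tnth_mktuple rpredB ?rpredZ ?lform_dhomog // dhomogX /= mdeg1. Qed.

Let sg1 i : tnth sg i \is 1.-homog.
Proof.
by rewrite tnth_mktuple rpredB ?rpredD ?rpredZ ?lform_dhomog // dhomogX /= mdeg1.
Qed.

Let pi_h : lform h \mPo pi = 0.
Proof.
rewrite comp_lform; under eq_bigr do rewrite tnth_mktuple scalerBr scalerA.
by rewrite sumrB -scaler_suml -/(lform h) [X in X *: _]hu scale1r subrr.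
Qed.

Let pi_l : lform l \mPo pi = lform l.
Proof.
rewrite comp_lform; under eq_bigr do rewrite tnth_mktuple scalerBr scalerA.
by rewrite sumrB -scaler_suml -/(lform l) [X in X *: _]lu scale0r subr0.
Qed.

Let l_neq0 : lform l != 0.
Proof.
apply/eqP => /(congr1 (meval w)); rewrite meval_lform [LHS]lw meval0.
by apply/eqP; rewrite oner_eq0.
Qed.

(** By [diff_comp], p is a combination of the differences X_i - pi_i = u_i h. *)
Lemma dvd_of_pi d p : p \is d.+1.-homog -> p \mPo pi = 0 ->
  exists2 q, q \is d.-homog & p = lform h * q.
Proof.
move=> hp p0; have [D [hD]] := diff_comp hp pi1; rewrite p0 subr0 => ->.
exists (\sum_i u i *: D i); first by apply: rpred_sum => i _; apply: rpredZ; exact: hD.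
rewrite mulr_sumr; apply: eq_bigr => i _.
by rewrite tnth_mktuple opprB addrCA subrr addr0 -!scalerAr mulrC.
Qed.

Lemma dvd_of_sg d p : p \is d.+1.-homog -> p \mPo sg = 0 ->
  exists q r, [/\ q \is d.-homog, r \is d.-homog & p = lform h * q + lform l * r].
Proof.
move=> hp p0; have [D [hD]] := diff_comp hp sg1; rewrite p0 subr0 => ->.
exists (\sum_i u i *: D i), (\sum_i w i *: D i).
split; try by apply: rpred_sum => i _; apply: rpredZ; exact: hD.
rewrite !mulr_sumr -big_split; apply: eq_bigr => i _ /=.
rewrite tnth_mktuple opprB addrCA subrr addr0 mulrDr.
by rewrite -!scalerAr ![D i * _]mulrC.
Qed.

Lemma L_h : L (lform h) = 0.
Proof.
rewrite raddf_sum /=; under eq_bigr do rewrite line_restrZ line_restrX scalerDr.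
rewrite big_split /=.
under [X in X + _]eq_bigr do rewrite -mul_polyC -polyCM.
under [X in _ + X]eq_bigr do rewrite -mul_polyC mulrA -polyCM.
by rewrite -mulr_suml -!raddf_sum [X in X%:P + _]he [X in _ + X%:P * _]he' mul0r addr0.
Qed.

Lemma L_pi d p : p \is d.+1.-homog -> p \mPo pi = 0 -> L p = 0.
Proof. by move=> hp /(dvd_of_pi hp) [q _ ->]; rewrite rmorphM /= L_h mul0r. Qed.

(** [sg] sends every point into the span of [e] and [e'], where p vanishes by [line_restr_eq0]. *)
Lemma sg_of_L d p : p \is d.-homog -> L p = 0 -> p \mPo sg = 0.
Proof.
move=> hp p0; apply: mpoly_eq_meval => v; rewrite meval0 comp_mpoly_meval.
have [s [t vE]] := basis v.
rewrite -[RHS](line_restr_eq0 s t hp p0); apply: meval_eq => i.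
rewrite tnth_mktuple mevalB mevalD !mevalZ !meval_lform mevalXU {1}vE.
by rewrite [u i * _]mulrC [w i * _]mulrC addrAC subrr add0r.
Qed.

(** Modulo h only the multiples of l remain, and l, fixed by [pi] and nonzero, can be cancelled. *)
Let pi_cancel_l f1 f2 q r q' r' :
  (f1 * (lform h * q + lform l * r) + f2 * (lform h * q' + lform l * r')) \mPo pi = 0 ->
  (f1 * r + f2 * r') \mPo pi = 0.
Proof.
have -> : f1 * (lform h * q + lform l * r) + f2 * (lform h * q' + lform l * r') =
    lform h * (f1 * q + f2 * q') + lform l * (f1 * r + f2 * r') by ring.
rewrite comp_mpolyD !rmorphM /= pi_h pi_l mul0r add0r => /eqP.
by rewrite mulf_eq0 (negPf l_neq0) => /eqP.
Qed.

(** On the line f1 v + f2 w' = 0 with f1 and f2 coprime, so f1 divides w', whose degree is too small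
    unless it vanishes there. *)
Lemma restr_eq0 f1 f2 k d v w' :
  f1 \is k.-homog -> f2 \is k.-homog ->
  size (L f1) = k.+1 -> coprimep (L f1) (L f2) -> (d < k)%N ->
  v \is d.-homog -> w' \is d.-homog ->
  (f1 * v + f2 * w') \mPo pi = 0 -> L v = 0 /\ L w' = 0.
Proof.
move=> hf1 hf2 sf1 cop dk hv hw' fvw.
have hs : f1 * v + f2 * w' \is (k.-1 + d).+1.-homog.
  by rewrite -addSn prednK ?(leq_trans _ dk) // rpredD // dhomogM.
have := L_pi hs fvw; rewrite rmorphD !rmorphM /= => L0.
have Lw : L w' = 0.
  apply/eqP; apply: contraTT dk => Lw.
  have /(dvdp_leq Lw) : L f1 %| L w'.
    by rewrite -(Gauss_dvdpr _ cop) -(dvdp_addr _ (dvdp_mulIl (L f1) (L v))) L0 dvdp0.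
  have [sw _] := line_restr_top e e' hw'.
  by rewrite sf1 -leqNgt => kd; rewrite -ltnS (leq_trans kd).
split=> //; move: L0; rewrite Lw mulr0 addr0 => /eqP; rewrite mulf_eq0 => /orP[|/eqP //].
by rewrite -size_poly_eq0 sf1.
Qed.

(** Modulo h there is no syzygy of degree below that of the Koszul one. By [restr_eq0] both
    coefficients vanish on the line, so modulo h they are multiples of l; cancel l and induct on the
    degree. *)
Lemma regular_lt f1 f2 k d v w' :
  f1 \is k.-homog -> f2 \is k.-homog ->
  size (L f1) = k.+1 -> coprimep (L f1) (L f2) -> (d < k)%N ->
  v \is d.-homog -> w' \is d.-homog ->
  (f1 * v + f2 * w') \mPo pi = 0 -> v \mPo pi = 0 /\ w' \mPo pi = 0.
Proof.
move=> hf1 hf2 sf1 cop; elim: d v w' => [|d IH] v w' dk hv hw' fvw.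
  have [] := restr_eq0 hf1 hf2 sf1 cop dk hv hw' fvw.
  have [c ->] := dhomog0_mpolyC hv; have [c' ->] := dhomog0_mpolyC hw'.
  rewrite /line_restr !mmapC => /eqP; rewrite polyC_eq0 => /eqP -> /eqP.
  by rewrite polyC_eq0 => /eqP ->; rewrite mpolyC0 comp_mpoly0.
have [L1 L2] := restr_eq0 hf1 hf2 sf1 cop dk hv hw' fvw.
have [q [r [hq hr Ev]]] := dvd_of_sg hv (sg_of_L hv L1).
have [q' [r' [hq' hr' Ew]]] := dvd_of_sg hw' (sg_of_L hw' L2).
have [||r0 r'0] := IH r r' _ hr hr'; first exact: ltnW.
  by move: fvw; rewrite Ev Ew; exact: pi_cancel_l.
by rewrite Ev Ew !comp_mpolyD !rmorphM /= pi_h r0 r'0 !mul0r !mulr0 addr0.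
Qed.

(** In the degree of the f's only the Koszul syzygy survives. On the line w' is a constant multiple
    of f1; subtracting that multiple of the Koszul syzygy leaves coefficients vanishing on the line,
    to which [regular_lt] applies after division by l. *)
Lemma regular_eq f1 f2 k v w' :
  f1 \is k.+1.-homog -> f2 \is k.+1.-homog ->
  size (L f1) = k.+2 -> coprimep (L f1) (L f2) ->
  v \is k.+1.-homog -> w' \is k.+1.-homog ->
  (f1 * v + f2 * w') \mPo pi = 0 ->
  exists c q, q \is k.-homog /\ w' = lform h * q + c *: f1.
Proof.
move=> hf1 hf2 sf1 cop hv hw' fvw.
have hs : f1 * v + f2 * w' \is (k + k.+1).+1.-homog.
  by rewrite -addSn rpredD // dhomogM.
have := L_pi hs fvw; rewrite rmorphD !rmorphM /= => L0.
have f10 : L f1 != 0 by rewrite -size_poly_eq0 sf1.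
have [c Lw] : exists c, L w' = c *: L f1.
  have [g Lw] : exists g, L w' = g * L f1.
    apply/dvdpP.
    by rewrite -(Gauss_dvdpr _ cop) -(dvdp_addr _ (dvdp_mulIl (L f1) (L v))) L0 dvdp0.
  have [sw _] := line_restr_top e e' hw'.
  have [g0|g0] := eqVneq g 0; first by exists 0; rewrite Lw g0 mul0r scale0r.
  exists g`_0; rewrite Lw -mul_polyC -size1_polyC //.
  by move: sw; rewrite Lw size_mul // sf1 addnS /= -[k.+2]add1n leq_add2r.
have Lv : L v = - c *: L f2.
  apply: (mulfI f10); apply/eqP; rewrite scaleNr mulrN -addr_eq0 -L0 Lw.
  by rewrite -!scalerAr [L f1 * L f2]mulrC.
have L1 : L (v + c *: f2) = 0 by rewrite rmorphD /= line_restrZ Lv scaleNr addNr.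
have L2 : L (w' - c *: f1) = 0 by rewrite rmorphB /= line_restrZ Lw subrr.
have h1 : v + c *: f2 \is k.+1.-homog by rewrite rpredD ?rpredZ.
have h2 : w' - c *: f1 \is k.+1.-homog by rewrite rpredB ?rpredZ.
have [q [r [hq hr Ev]]] := dvd_of_sg h1 (sg_of_L h1 L1).
have [q' [r' [hq' hr' Ew]]] := dvd_of_sg h2 (sg_of_L h2 L2).
have {}fvw : (f1 * (v + c *: f2) + f2 * (w' - c *: f1)) \mPo pi = 0.
  rewrite -fvw !mulrDr mulrN -!scalerAr [f2 * f1]mulrC.
  by rewrite addrACA subrr addr0.
have [|r0 r'0] := regular_lt hf1 hf2 sf1 cop (ltnSn k) hr hr'.
  by move: fvw; rewrite Ev Ew; exact: pi_cancel_l.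
exists c; have [|g hg Eg] := @dvd_of_pi k (w' - c *: f1) h2.
  by rewrite Ew !comp_mpolyD !rmorphM /= pi_h r'0 !mul0r !mulr0 addr0.
by exists g; split=> //; rewrite -Eg subrK.
Qed.
End Regular.

(** Coordinates adapted to a line inside h = a = 0. The rank decomposition of the matrix with rows h
    and a writes both through two members r_0, r_1 of a basis of linear forms; [e] and [e'] are the
    last two vectors of the dual basis. The case of a proportional to h is included. *)
Lemma splitting (K : fieldType) (h a : 'I_4 -> K) :
  (exists i, h i != 0) ->
  let ev (b v : 'I_4 -> K) := \sum_i b i * v i in
  exists l u w e e' : 'I_4 -> K,
  [/\ [/\ ev h u = 1, ev h w = 0, ev h e = 0 & ev h e' = 0],
      [/\ ev l u = 0, ev l w = 1, ev l e = 0 & ev l e' = 0],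
      [/\ ev a e = 0, ev a e' = 0 & forall s t, (s != 0) || (t != 0) ->
         exists i, s * e i + t * e' i != 0] &
      forall v, exists s t, forall i,
        v i = ev h v * u i + ev l v * w i + (s * e i + t * e' i)].
Proof.
move=> [i0 hi0] ev.
pose A : 'M[K]_(2, 4) := \matrix_(k, i) if k == 0 then h i else a i.
pose r k := row_ebase A k; pose q k i := invmx (row_ebase A) i k.
pose c k j := (col_ebase A *m (pid_mx (\rank A) : 'M_(2, 4))) k j.
have cE k (j : 'I_4) : (1 < j)%N -> c k j = 0.
  move=> j1; rewrite /c mxE big1 // => m _; rewrite mxE.
  by case: eqP => [mj|]; rewrite ?mulr0 //; move: j1; rewrite -mj; case: (m) => [[|[]]].
have AE k i : A k i = c k 0 * r 0 i + c k 1 * r 1 i.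
  rewrite -{1}[A]mulmx_ebase mxE (bigD1 0) //= (bigD1 1) //= big1 ?addr0 // => j.
  case/andP=> j0 j1; rewrite -/(c k j) cE ?mul0r //.
  by case: j j0 j1 => [[|[|]]].
have rq k k' : ev (r k) (q k') = (k == k')%:R.
  have := mulmxV (row_ebase_unit A) => /matrixP /(_ k k').
  by rewrite !mxE => <-; apply: eq_bigr => i _.
have qr v i : v i = \sum_k ev (r k) v * q k i.
  have := mulVmx (row_ebase_unit A) => /matrixP M.
  under eq_bigr do rewrite mulr_suml.
  rewrite exchange_big /= (bigD1 i) //= [X in _ + X]big1 ?addr0 => [|j ji].
    under eq_bigr do rewrite mulrAC mulrC.
    rewrite -mulr_sumr; have := M i i; rewrite !mxE eqxx => /= e.
    by under eq_bigr do rewrite mulrC; rewrite e mulr1.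
  under eq_bigr do rewrite mulrAC mulrC.
  rewrite -mulr_sumr; have := M i j; rewrite !mxE eq_sym (negPf ji) => /= e.
  by under eq_bigr do rewrite mulrC; rewrite e mulr0.
have evD b x y s t : ev b (fun i => s * x i + t * y i) = s * ev b x + t * ev b y.
  rewrite /ev !mulr_sumr -big_split; apply: eq_bigr => i _ /=; ring.
have evh k : ev h (q k) = c 0 0 * (0 == k)%:R + c 0 1 * (1 == k)%:R.
  rewrite -!rq !mulr_sumr -big_split; apply: eq_bigr => i _ /=.
  by have := AE 0 i; rewrite mxE /= => ->; ring.
have eva k : ev a (q k) = c 1 0 * (0 == k)%:R + c 1 1 * (1 == k)%:R.
  rewrite -!rq !mulr_sumr -big_split; apply: eq_bigr => i _ /=.
  by have := AE 1 i; rewrite mxE /= => ->; ring.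
have evhv v : ev h v = c 0 0 * ev (r 0) v + c 0 1 * ev (r 1) v.
  rewrite !mulr_sumr -big_split; apply: eq_bigr => i _ /=.
  by have := AE 0 i; rewrite mxE /= => ->; ring.
have indep s t : (s != 0) || (t != 0) -> exists i, s * q 2 i + t * q 3 i != 0.
  move=> st; apply: contrapT => /forallNP h0.
  have z k : ev (r k) (fun i => s * q 2 i + t * q 3 i) = 0.
    by apply: big1 => i _; have /negP := h0 i; rewrite negbK => /eqP ->; rewrite mulr0.
  move: (z 2) (z 3) st; rewrite !evD !rq /= !mulr0 !mulr1 addr0 add0r => -> ->.
  by rewrite eqxx.
have fin l u w : ev h u = 1 -> ev h w = 0 -> ev l u = 0 -> ev l w = 1 ->
    ev l (q 2) = 0 -> ev l (q 3) = 0 ->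
    (forall v i, ev (r 0) v * q 0 i + ev (r 1) v * q 1 i = ev h v * u i + ev l v * w i) ->
    exists l u w e e' : 'I_4 -> K,
    [/\ [/\ ev h u = 1, ev h w = 0, ev h e = 0 & ev h e' = 0],
        [/\ ev l u = 0, ev l w = 1, ev l e = 0 & ev l e' = 0],
        [/\ ev a e = 0, ev a e' = 0 & forall s t, (s != 0) || (t != 0) ->
           exists i, s * e i + t * e' i != 0] &
        forall v, exists s t, forall i,
          v i = ev h v * u i + ev l v * w i + (s * e i + t * e' i)].
  move=> hu hw lu lw l2 l3 huw; exists l, u, w, (q 2), (q 3).
  split; [|by []|by split; rewrite ?eva //= !mulr0 addr0|].
    by split; rewrite // evh /= !mulr0 addr0.
  move=> v; exists (ev (r 2) v), (ev (r 3) v) => i; rewrite -huw {1}(qr v i).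
  rewrite (bigD1 0) //= (bigD1 1) //= (bigD1 2) //= (bigD1 3) //= big1 ?addr0 => [|j].
    exact: addrA.
  by case: j => [[|[|[|[|]]]]].
have hr k v b : ev (r k) (fun i => b * v i) = b * ev (r k) v.
  by rewrite /ev mulr_sumr; apply: eq_bigr => i _; ring.
(* As h = c_00 r_0 + c_01 r_1 is nonzero, r_0 completes it if c_00 = 0, and r_1 does otherwise; that
   form is taken as l. *)
have [c0|c0] := eqVneq (c 0 0) 0.
  have c1 : c 0 1 != 0.
    apply: contraNneq hi0 => c1; have := AE 0 i0; rewrite mxE /= => ->.
    by rewrite c0 c1 !mul0r addr0.
  apply: (fin (r 0) (fun i => (c 0 1)^-1 * q 1 i) (q 0)).
  - by rewrite evhv !hr !rq c0 mul0r add0r mulr1 mulfV.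
  - by rewrite evh c0 mul0r mulr0 addr0.
  - by rewrite hr rq mulr0.
  - by rewrite rq.
  - by rewrite rq.
  - by rewrite rq.
  - by move=> v i; rewrite evhv c0; field.
apply: (fin (r 1) (fun i => (c 0 0)^-1 * q 0 i) (fun i => - (c 0 1 / c 0 0) * q 0 i + 1 * q 1 i)).
- by rewrite evhv !hr !rq mulr0 mulr0 addr0 mulr1 mulfV.
- by rewrite evD !evh /=; field.
- by rewrite hr rq mulr0.
- by rewrite evD !rq mulr0 add0r mulr1.
- by rewrite rq.
- by rewrite rq.
- by move=> v i; rewrite evhv; field.
Qed.

(** * Dimension count in degree 6 *)

Section Mul.
Variables (K : fieldType) (n c d : nat) (f : {mpoly K[n.+1]}).

(** The projection to degree [c] makes this a total linear map; it changes nothing when the degrees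
    add up, see [hmulE]. *)
Definition hmul (g : dhomog n.+1 K d) : dhomog n.+1 K c :=
  DHomog (pihomogP mdeg c (f * val g)).

Fact hmul_is_linear : linear hmul.
Proof. by move=> a x y; apply/val_inj; rewrite /= mulrDr -scalerAr linearP. Qed.
HB.instance Definition _ := GRing.isLinear.Build K _ _ _ hmul hmul_is_linear.

Lemma hmulE e g : f \is e.-homog -> (e + d)%N = c -> val (hmul g) = f * val g.
Proof. by move=> hf ec; rewrite /= pihomog_dE // -ec dhomogM // dhomog_is_dhomog. Qed.

Lemma dim_dhomog : \dim {:dhomog n.+1 K d} = 'C(d + n, d).
Proof. by rewrite dimvf. Qed.

Lemma dim_hmul_le : (\dim (limg (linfun hmul)) <= 'C(d + n, d))%N.
Proof. by rewrite -dim_dhomog -(limg_ker_dim (linfun hmul) fullv) leq_addl. Qed.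

Lemma dim_hmul e : f \is e.-homog -> (e + d)%N = c -> f != 0 ->
  \dim (limg (linfun hmul)) = 'C(d + n, d).
Proof.
move=> hf ac f0; rewrite -dim_dhomog; apply/limg_dim_eq/eqP.
rewrite capfv -subv0; apply/subvP => g; rewrite memv_ker lfunE /= memv0 => /eqP g0.
have := hmulE g hf ac; rewrite g0 /= => /esym /eqP; rewrite mulf_eq0 (negPf f0) /= => /eqP gz.
by apply/eqP/val_inj.
Qed.
End Mul.
Arguments hmul {K n} c d f.

Lemma dim_addv_le (K : fieldType) (vT : vectType K) (U V : {vspace vT}) :
  (\dim (U + V) <= \dim U + \dim V)%N.
Proof. by rewrite -dimv_sum_cap leq_addr. Qed.

Section Count.
Variable K : numClosedFieldType.
Local Notation S d := (dhomog 4 K d).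
Local Notation img d f := (limg (linfun (hmul 6 d f : S d -> S 6))).

Lemma mem_img k d (f : {mpoly K[4]}) (x : S 6) : f \is k.-homog -> (k + d)%N = 6%N ->
  x \in img d f -> exists2 g : {mpoly K[4]}, g \is d.-homog & val x = f * g.
Proof.
move=> hf ad /memv_imgP [g _ ->]; exists (val g); first exact: dhomog_is_dhomog.
by rewrite lfunE; exact: hmulE hf ad.
Qed.

Lemma img_mem k d (f g : {mpoly K[4]}) (x : S 6) : f \is k.-homog -> (k + d)%N = 6%N ->
  g \is d.-homog -> val x = f * g -> x \in img d f.
Proof.
move=> hf ad hg xE; apply/memv_imgP; exists (DHomog hg); first exact: memvf.
by apply/val_inj; rewrite lfunE xE; apply/esym; exact: hmulE hf ad.
Qed.

Lemma dim_gt0 (U : {vspace S 6}) x : x \in U -> val x != 0 -> (0 < \dim U)%N.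
Proof.
move=> xU; apply: contra_neqT; rewrite -eqn0Ngt dimv_eq0 => /eqP U0.
by move: xU; rewrite U0 memv0 => /eqP ->.
Qed.

Lemma dim_img3_le (f : {mpoly K[4]}) : (\dim (img 3 f) <= 20)%N.
Proof. exact: leq_trans (dim_hmul_le 6 3 f) _. Qed.

Lemma img0 : img 3 (0 : {mpoly K[4]}) = 0%VS.
Proof.
apply/eqP; rewrite -subv0; apply/subvP => x.
move=> /(mem_img (dhomog0 K mdeg 3) (erefl 6%N)) [v _].
by rewrite mul0r memv0 => /(@val_inj _ _ _ x 0) ->.
Qed.

(** 39 = 20 + 20 - 1: there are 20 independent cubics, and [f * g] lies in both images. *)
Lemma dim_sum2_le (f g : {mpoly K[4]}) : f \is 3.-homog -> g \is 3.-homog ->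
  (\dim (img 3 f + img 3 g) <= 39)%N.
Proof.
move=> hf hg; have := dimv_sum_cap (img 3 f) (img 3 g).
have df := dim_img3_le f; have dg := dim_img3_le g.
have [->|f0] := eqVneq f 0; first by rewrite img0 add0v; lia.
have [->|g0] := eqVneq g 0; first by rewrite img0 addv0; lia.
have : (0 < \dim (img 3 f :&: img 3 g))%N.
  have hfg : f * g \is 6.-homog by exact: dhomogM hf hg.
  apply: (@dim_gt0 _ (DHomog hfg)); last by rewrite /= mulf_neq0.
  by rewrite memv_cap (img_mem hf _ hg) //= (img_mem hg _ hf) //= mulrC.
lia.
Qed.

(** 58 = 39 + 20 - 1, the common element now being [f * h]. *)
Lemma dim_sum3_le (f g h : {mpoly K[4]}) :
  f \is 3.-homog -> g \is 3.-homog -> h \is 3.-homog ->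
  (\dim (img 3 f + img 3 g + img 3 h) <= 58)%N.
Proof.
move=> hf hg hh; have := dimv_sum_cap (img 3 f + img 3 g)%VS (img 3 h).
have dh := dim_img3_le h; have dfg := dim_sum2_le hf hg.
have [h0|h0] := eqVneq h 0.
  by rewrite h0 img0 addv0; lia.
have [f0|f0] := eqVneq f 0.
  by rewrite f0 img0 add0v; have := dim_img3_le g; lia.
have : (0 < \dim ((img 3 f + img 3 g) :&: img 3 h))%N.
  have hfh : f * h \is 6.-homog by exact: dhomogM hf hh.
  apply: (@dim_gt0 _ (DHomog hfh)); last by rewrite /= mulf_neq0.
  rewrite memv_cap (subvP (addvSl _ _) _ (img_mem hf _ hh _)) //=.
  by rewrite (img_mem hh _ hf) //= mulrC.
lia.
Qed.

Variables (h l u w e e' : 'I_4 -> K).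
Local Notation ev a v := (\sum_i a i * v i).
Hypotheses (hu : ev h u = 1) (he : ev h e = 0) (he' : ev h e' = 0).
Hypotheses (lu : ev l u = 0) (lw : ev l w = 1).
Hypothesis basis : forall v, exists s t, forall i,
  v i = ev h v * u i + ev l v * w i + (s * e i + t * e' i).

(** 75 = 56 + 20 + 20 - 10 - 11, where 56 counts the quintics, 20 the cubics, and 10 and 11 bound
    the two intersections. *)
Lemma dim_regular_ge f1 f2 : f1 \is 3.-homog -> f2 \is 3.-homog ->
  size (line_restr e e' f1) = 4%N ->
  coprimep (line_restr e e' f1) (line_restr e e' f2) ->
  (75 <= \dim (img 5 (lform h) + img 3 f1 + img 3 f2))%N.
Proof.
move=> hf1 hf2 sf1 cop.
set pi := [tuple 'X_i - u i *: lform h | i < 4].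
have hh := lform_dhomog h.
have f10 : f1 \mPo pi != 0.
  by apply: contra_eqN sf1 => /eqP /(@L_pi _ _ h u e e' he he' _ _ hf1) ->; rewrite size_poly0.
have nf1 : f1 != 0 by apply: contraNneq f10 => ->; rewrite comp_mpoly0.
have nh : lform h != 0.
  apply/eqP => /(congr1 (meval u)); rewrite meval_lform [LHS]hu meval0.
  by apply/eqP; rewrite oner_eq0.
have pih : lform h \mPo pi = 0.
  rewrite comp_lform; under eq_bigr do rewrite tnth_mktuple scalerBr scalerA.
  by rewrite sumrB -scaler_suml -/(lform h) [X in X *: _]hu scale1r subrr.
have dh : \dim (img 5 (lform h)) = 56%N by rewrite (dim_hmul hh).
have d1 : \dim (img 3 f1) = 20%N by rewrite (dim_hmul hf1).
have nf2 : f2 != 0.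
  apply: contraTneq cop => ->; rewrite /line_restr mmap0 coprimep0.
  by rewrite -size_poly_eq1 sf1.
have d2 : \dim (img 3 f2) = 20%N by rewrite (dim_hmul hf2).
have hhf f : f \is 3.-homog -> lform h * f \is 4.-homog by exact: dhomogM hh.
(* If h g = f1 v, then h divides v since f1 is nonzero modulo h; so the intersection consists of h
   f1 times quadrics. *)
have c1 : (\dim (img 5 (lform h) :&: img 3 f1) <= 10)%N.
  apply: leq_trans (dim_hmul_le 6 2 (lform h * f1)); apply: dimvS.
  apply/subvP => x; rewrite memv_cap => /andP[/(mem_img hh erefl) [g hg xg]].
  move=> /(mem_img hf1 erefl) [v hv xv].
  have /(dvd_of_pi hv) [q hq vq] : v \mPo pi = 0.
    apply: (mulfI f10); rewrite mulr0 -rmorphM -xv xg rmorphM /= pih mul0r //.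
  apply: (img_mem (hhf _ hf1) erefl hq).
  by rewrite xv vq mulrCA mulrA.
(* By [regular_eq] the intersection lies in h f2 times quadrics, plus the line of the Koszul element
   f1 f2. *)
have c2 : (\dim ((img 5 (lform h) + img 3 f1) :&: img 3 f2) <= 11)%N.
  have h12 : f1 * f2 \is 6.-homog by exact: dhomogM hf1 hf2.
  have: (\dim (img 2 (lform h * f2) + <[(DHomog h12 : S 6)]>) <= 11)%N.
    apply: leq_trans (dim_addv_le _ _) _.
    by apply: leq_add (dim_hmul_le 6 2 _) _; rewrite dim_vline leq_b1.
  apply: leq_trans; apply: dimvS.
  apply/subvP => x; rewrite memv_cap => /andP[/memv_addP [y yh [z zf xyz]]].
  move: yh zf => /(mem_img hh erefl) [g hg yg] /(mem_img hf1 erefl) [v hv zv].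
  move=> /(mem_img hf2 erefl) [w' hw' xw].
  have [||c [q [hq wq]]] := regular_eq hu he he' lu lw basis hf1 hf2 sf1 cop (v := - v) _ hw'.
  - by rewrite rpredN.
  - have -> : f1 * - v + f2 * w' = lform h * g.
      by rewrite -xw xyz raddfD /= yg zv mulrN addrCA addNr addr0.
    by rewrite rmorphM /= pih mul0r.
  have hqf : lform h * f2 * q \is 6.-homog by exact: dhomogM (hhf _ hf2) hq.
  apply/memv_addP; exists (DHomog hqf : S 6).
    exact: (img_mem (hhf _ hf2) erefl hq).
  exists (c *: (DHomog h12 : S 6)); first by rewrite memvZ ?memv_line.
  apply/val_inj; rewrite xw wq raddfD /= mulrDr -scalerAr.
  by rewrite mulrA [f2 * lform h]mulrC [f2 * f1]mulrC.
have s1 := dimv_sum_cap (img 5 (lform h)) (img 3 f1).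
have := dimv_sum_cap (img 5 (lform h) + img 3 f1)%VS (img 3 f2).
lia.
Qed.
End Count.

(** The line from [splitting] lies in h = 0, as [dim_regular_ge] requires, and in a = 0, where the
    cubics have no common zero. The space of dimension at least 75 would then sit inside one of
    dimension at most 58 + 16. *)
Lemma count_contradiction (K : numClosedFieldType) (f : 'I_3 -> {mpoly K[4]})
    (h : {mpoly K[4]}) (a : 'I_4 -> K) m (U : 'I_m -> {mpoly K[4]}) :
  (forall i, f i \is 3.-homog) ->
  (forall x, (exists i, x i != 0) -> \sum_i a i * x i = 0 -> exists i, (f i).@[x] != 0) ->
  h \is 1.-homog -> h != 0 -> (m <= 16)%N -> (forall p, U p \is 6.-homog) ->
  ~ (forall g, g \is 5.-homog -> exists (b : 'I_3 -> {mpoly K[4]}) (r : 'I_m -> K),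
       (forall i, b i \is 3.-homog) /\ h * g = \sum_i f i * b i + \sum_p r p *: U p).
Proof.
move=> hf nz hh h0 m16 hU span.
have [hc def_h] := dhomog1_lform hh.
have hc0 : exists i, hc i != 0.
  apply: contrapT => /forallNP hc0; case/eqP: h0; rewrite def_h; apply: big1 => i _.
  by have /negP := hc0 i; rewrite negbK => /eqP ->; rewrite scale0r.
have [l [u [w [e [e' [[hu hw he he'] [lu lw le le'] [ae ae' ind] basis]]]]]] := splitting a hc0.
have evD s t : \sum_i a i * (s * e i + t * e' i) = 0.
  transitivity (s * (\sum_i a i * e i) + t * (\sum_i a i * e' i)).
    by rewrite !mulr_sumr -big_split; apply: eq_bigr => i _ /=; ring.
  by rewrite ae ae' !mulr0 addr0.
have [i [b [si cop]]] := line_coprime_combination hf (fun s t st => nz _ (ind s t st) (evD s t)).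
have hg : \sum_j b j *: f j \is 3.-homog by apply: rpred_sum => j _; apply: rpredZ.
have := dim_regular_ge hu he he' lu lw basis (hf i) hg si cop.
rewrite -def_h; apply/negP; rewrite -ltnNge.
pose F k := limg (linfun (hmul 6 3 (f k) : dhomog 4 K 3 -> dhomog 4 K 6)).
pose V := <<[seq (DHomog (hU p) : dhomog 4 K 6) | p <- enum 'I_m]>>%VS.
pose W := (F 0%R + F 1%R + F 2%R)%VS.
have sF k : (F k <= W)%VS.
  have : k \in [:: 0; 1; 2] by case: k => [[|[|[|]]]].
  rewrite !inE => /or3P[] /eqP ->.
  - exact: subv_trans (addvSl _ _) (addvSl _ _).
  - exact: subv_trans (addvSr _ _) (addvSl _ _).
  - exact: addvSr.
have memW c x : c \is 3.-homog -> (exists k, val x = f k * c) -> x \in W.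
  by move=> hc3 [k xE]; apply: (subvP (sF k)); apply: img_mem (hf k) _ hc3 xE.
have dV : (\dim V <= 16)%N.
  by apply: leq_trans (dim_span _) _; rewrite size_map size_enum_ord.
have dW : (\dim W <= 58)%N by exact: dim_sum3_le (hf 0) (hf 1) (hf 2).
have : (\dim (W + V) < 75)%N.
  by rewrite ltnS; apply: leq_trans (dim_addv_le _ _) _; exact: (@leq_add _ _ 58 16).
apply: leq_ltn_trans; apply: dimvS.
apply/subvP => x /memv_addP [y /memv_addP [z zh [t tf ->]] [v vg ->]].
rewrite -addrA; apply: rpredD; last apply: (subvP (addvSl _ _)); last apply: rpredD.
- have [g hg5 zE] := mem_img hh erefl zh.
  have [c [r [hc3 cE]]] := span g hg5.
  have hfc k : f k * c k \is 6.-homog by exact: dhomogM (hf k) (hc3 k).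
  apply/memv_addP; exists (\sum_k (DHomog (hfc k) : dhomog 4 K 6)).
    by apply: rpred_sum => k _; apply: (memW (c k)); last by exists k.
  exists (\sum_p r p *: (DHomog (hU p) : dhomog 4 K 6)).
    apply: rpred_sum => p _; apply: rpredZ; apply: memv_span.
    by apply/mapP; exists p; rewrite ?mem_enum.
  by apply/val_inj; rewrite zE cE raddfD !raddf_sum /=.
- have [g hg3 tE] := mem_img (hf i) erefl tf.
  by apply: memW hg3 _; exists i.
have [g hg3 vE] := mem_img hg erefl vg.
have hfg k : f k * g \is 6.-homog by exact: dhomogM (hf k) hg3.
have -> : v = \sum_k b k *: (DHomog (hfg k) : dhomog 4 K 6).
  apply/val_inj; rewrite vE raddf_sum mulr_suml; apply: eq_bigr => k _ /=.
  by rewrite scalerAl.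
by apply: rpred_sum => k _; apply: rpredZ; apply: memW hg3 _; exists k.
Qed.

(** * The Bezoutian *)

Lemma det_dhomog (K : comNzRingType) n k (A : 'M[{mpoly K[k]}]_n) (e : 'I_n -> nat) :
  (forall i j, A i j \is (e i).-homog) -> \det A \is (\sum_i e i)%N.-homog.
Proof.
move=> hA; apply: rpred_sum => s _; rewrite mulr_sign.
suff h : \prod_i A i (s i) \is (\sum_i e i)%N.-homog by case: ifP; rewrite ?rpredN.
elim/big_rec2: _ => [|i d q _ hq]; first exact: dhomog1.
by rewrite dhomogM.
Qed.

Section Bezoutian.
Variable K : fieldType.
Variables (f : 'I_3 -> {mpoly K[4]}) (a : 'I_4 -> K).
Variables (m : nat) (p : 'I_m -> 'I_4 -> K) (c : 'I_m -> K).
Hypothesis hf : forall i, f i \is 3.-homog.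
Hypothesis fp : forall i k, (f i).@[p k] = 0.
Hypothesis ap : forall k, \sum_i a i * p k i = 1.
Hypothesis c4 : forall G, G \is 4.-homog -> \sum_k c k * G.@[p k] = 0.
Hypothesis a_neq0 : lform a != 0.
Hypothesis p_inj : forall k k', p k =1 p k' -> k = k'.

Let ell := lform a.
(** The factor [ell] makes the substitution y = p_k homogeneous of degree 1; since ell(p_k) = 1, it
    also gives ell(y) = ell(x). *)
Let yp k : 4.-tuple {mpoly K[4]} := [tuple ell * (p k i)%:MP | i < 4].
Let xs : 4.-tuple {mpoly K[4]} := [tuple 'X_i | i < 4].
Let s k := spec xs (yp k).
Let Lam u := \sum_k c k *: (u \mPo s k).

Let hs k i : tnth (s k) i \is 1.-homog.
Proof.
rewrite tnth_mktuple; case: fintype.split => j; first by rewrite tnth_mktuple dhomogX /= mdeg1.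
by rewrite tnth_mktuple mulrC mul_mpolyC rpredZ // lform_dhomog.
Qed.

Let hell k : ell ^+ k \is k.-homog.
Proof. by have := dhomogMn k (lform_dhomog a); rewrite mul1n. Qed.

(* A monomial of degree at most 4 in y is killed by the relation [c4], and one of
   degree at least 5 specializes to a multiple of [ell ^+ 5]. *)
Lemma Lam_divisible N u : u \is N.-homog ->
  exists2 b, b \is (N - 5)%N.-homog & Lam u = ell ^+ 5 * b.
Proof.
move=> hu.
have mono (mm : 'X_{1..4 + 4}) : mm \in msupp u ->
    exists2 b, b \is (N - 5)%N.-homog & Lam 'X_[mm] = ell ^+ 5 * b.
  move=> mmu; have := msupp_dhomog_sum hu mmu; rewrite big_split_ord /=.
  set R := (\sum_(i < 4) mm (rshift 4 i))%N.
  set mL := [multinom mm (lshift 4 i) | i < 4]; set mR := [multinom mm (rshift 4 i) | i < 4].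
  have dL : (\sum_(i < 4) mm (lshift 4 i) = mdeg mL)%N.
    by rewrite mdegE; apply: eq_bigr => i _; rewrite mnmE.
  have dR : R = mdeg mR by rewrite mdegE; apply: eq_bigr => i _; rewrite mnmE.
  rewrite dL => sN.
  have Xs k : 'X_[mm] \mPo s k = 'X_[mR].@[p k] *: (ell ^+ R * 'X_[mL]).
    rewrite comp_mpolyX big_split_ord /= mulrC -mul_mpolyC mulrA; congr (_ * _).
      rewrite mevalX rmorph_prod mulrC -prodrXr -big_split; apply: eq_bigr => i _ /=.
      by rewrite tnth_spec_r tnth_mktuple exprMn rmorphXn mnmE.
    rewrite mpolyXE_id; apply: eq_bigr => i _.
    by rewrite tnth_spec_l tnth_mktuple mnmE.
  have -> : Lam 'X_[mm] = (\sum_k c k * 'X_[mR].@[p k]) *: (ell ^+ R * 'X_[mL]).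
    by rewrite scaler_suml; apply: eq_bigr => k _; rewrite Xs scalerA.
  case: (ltnP R 5) => R5.
    exists 0; first exact: rpred0.
    rewrite mulr0 -[X in X *: _]/(_ : K) (_ : \sum_k _ = 0) ?scale0r //.
    (* A power of [ell], equal to 1 at every p_k, pads the monomial in y to degree exactly 4. *)
    rewrite -[RHS](c4 (G := 'X_[mR] * ell ^+ (4 - R))); last first.
      have hR : ('X_[mR] : {mpoly K[4]}) \is R.-homog by rewrite dhomogX /= dR.
      by have := dhomogM hR (hell (4 - R)); rewrite subnKC.
    apply: eq_bigr => k _; rewrite mevalM rmorphXn /= meval_lform ap expr1n mulr1 //.
  exists ((\sum_k c k * 'X_[mR].@[p k]) *: (ell ^+ (R - 5) * 'X_[mL])).
    rewrite rpredZ // -sN addnC -addnBAC //.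
    apply: dhomogM; last by rewrite dhomogX.
    exact: hell.
  by rewrite -scalerAr mulrA -exprD subnKC.
have -> : Lam u = \sum_(mm <- msupp u) u@_mm *: Lam 'X_[mm].
  rewrite /Lam; under [RHS]eq_bigr do rewrite scaler_sumr.
  rewrite exchange_big; apply: eq_bigr => k _; rewrite [u \mPo _]comp_mpolyEX scaler_sumr.
  by apply: eq_bigr => mm _; rewrite !scalerA mulrC.
rewrite big_seq.
elim/big_rec: _ => [|mm q mmu [b hb ->]]; first by exists 0; rewrite ?mulr0 ?rpred0.
have [b' hb' ->] := mono mm mmu.
exists (u@_mm *: b' + b); first by rewrite rpredD ?rpredZ.
by rewrite mulrDr scalerAr.
Qed.

Definition phi (i : 'I_4) := if unlift ord0 i is Some k then f k else ell.

Lemma bezoutian : exists (h : {mpoly K[4]}) (U : 'I_m -> {mpoly K[4]}),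
  [/\ h \is 1.-homog, forall k, U k \is 6.-homog,
      forall g, g \is 5.-homog -> exists (b : 'I_3 -> {mpoly K[4]}) (r : 'I_m -> K),
       (forall i, b i \is 3.-homog) /\ h * g = \sum_i f i * b i + \sum_p r p *: U p &
      forall q, h.@[p q] = c q * \det (\matrix_(i, j) ((phi i)^`M(j)).@[p q])].
Proof.
(* Degrees of the rows of [T]: 0 for [ell], 2 for each cubic. They add up to 6, and to 4 once the
   row of a cubic is deleted. *)
pose e (i : 'I_4) := if val i == 0%N then 0%N else 2.
have hphi i : phi i \is (e i).+1.-homog.
  rewrite /phi /e; case: unliftP => [j ->|->] //=; exact: lform_dhomog.
have /fin_all_exists [th hth] : forall i, exists D : 'I_4 -> {mpoly K[4 + 4]},
    (forall j, D j \is (e i).-homog) /\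
    (phi i \mPo xvars K 4) - (phi i \mPo yvars K 4)
    = \sum_j D j * ('X_(lshift 4 j) - 'X_(rshift 4 j)).
  by move=> i; have [D [hD eD]] := diff_quotient (hphi i); exists D.
pose T : 'M[{mpoly K[4 + 4]}]_4 := \matrix_(i, j) th i j.
pose d j : {mpoly K[4 + 4]} := 'X_(lshift 4 j) - 'X_(rshift 4 j).
pose del := \det T.
(* The matrix [T] maps the vector of the x_j - y_j to that of the phi_i(x) - phi_i(y); multiply by
   the adjugate. *)
have cramer j : del * d j = \sum_i cofactor T i j *
    ((phi i \mPo xvars K 4) - (phi i \mPo yvars K 4)).
  pose v := \col_j d j.
  have Tv i : (T *m v) i 0 = (phi i \mPo xvars K 4) - (phi i \mPo yvars K 4).
    by rewrite mxE (hth i).2; apply: eq_bigr => l _; rewrite !mxE.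
  have /matrixP /(_ j 0) : \adj T *m (T *m v) = del *: v.
    by rewrite mulmxA mul_adj_mx mul_scalar_mx.
  rewrite [RHS]mxE [v _ _]mxE => <-; rewrite mxE; apply: eq_bigr => i _.
  by rewrite Tv mxE.
have comp_s q k : ((q \mPo xvars K 4) - (q \mPo yvars K 4)) \mPo s k = q - (q \mPo yp k).
  by rewrite comp_mpolyB comp_xvars comp_yvars comp_mpoly_id.
(* At y = ell(x) p_k the [ell] row cancels, and each cubic loses its y-part because it vanishes at
   p_k. *)
have phi_s i k : ((phi i \mPo xvars K 4) - (phi i \mPo yvars K 4)) \mPo s k =
   if unlift ord0 i is Some j then f j else 0.
  rewrite comp_s (comp_mpoly_scale _ _ (hphi i)) /phi.
  case: unliftP => [j ->|->]; first by rewrite fp mpolyC0 mulr0 subr0.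
  by rewrite /e /= expr1 meval_lform ap mpolyC1 mulr1 subrr.
have hdel : del \is 6.-homog.
  have := det_dhomog (A := T) (e := e); rewrite !big_ord_recl big_ord0; apply => i j.
  by rewrite mxE; exact: (hth i).1.
have hcof (i : 'I_3) j : cofactor T (lift ord0 i) j \is 4.-homog.
  rewrite /cofactor -signr_odd mulr_sign.
  suff : \det (row' (lift ord0 i) (col' j T)) \is 4.-homog by case: ifP; rewrite ?rpredN.
  have := @det_dhomog _ _ _ (row' (lift ord0 i) (col' j T)) (fun k => e (lift (lift ord0 i) k)).
  rewrite !big_ord_recl big_ord0.
  have -> : (e (lift (lift ord0 i) ord0) + (e (lift (lift ord0 i) (lift ord0 ord0)) +
    (e (lift (lift ord0 i) (lift ord0 (lift ord0 ord0))) + 0)) = 4)%N.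
    by case: (i) => [[|[|[|]]]].
  by apply=> k l; rewrite !mxE; exact: (hth _).1.
have cramer_s j k : (del \mPo s k) * (d j \mPo s k) =
    \sum_(i < 3) (cofactor T (lift ord0 i) j \mPo s k) * f i.
  rewrite -rmorphM /= cramer (raddf_sum (comp_mpoly (s k))) /= big_ord_recl.
  rewrite !rmorphM /= phi_s unlift_none mulr0 add0r; apply: eq_bigr => i _.
  by rewrite rmorphM /= phi_s liftK.
have hU k : del \mPo s k \is 6.-homog.
  by rewrite -[6%N]mul1n; apply: comp_dhomog.
have [h hh hE] := Lam_divisible hdel.
exists h, (fun k => del \mPo s k); split=> //.
  move=> g hg; have [D [hD eD]] := diff_quotient hg.
  (* Degree 4 + 4 = 8, so that [Lam (E i)] is ell^5 times a form of degree 3. *)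
  pose E (i : 'I_3) := \sum_j D j * cofactor T (lift ord0 i) j.
  have hE8 i : E i \is 8.-homog.
    by apply: rpred_sum => j _; exact: dhomogM (hD j) (hcof i j).
  have /fin_all_exists [b hb] : forall i, exists b, b \is 3.-homog /\ Lam (E i) = ell ^+ 5 * b.
    by move=> i; have [b ? ?] := Lam_divisible (hE8 i); exists b.
  exists b, (fun k => c k * g.@[p k]); split=> [i|]; first by have [] := hb i.
  (* g(x) - g(ell p_k) is a combination of the differences x_j - y_j, to which Cramer's rule
     applies. Summing with weights c_k and cancelling ell^5 gives the claim. *)
  have idk k : (del \mPo s k) * (g - ell ^+ 5 * (g.@[p k])%:MP) = \sum_i f i * (E i \mPo s k).
    have -> : g - ell ^+ 5 * (g.@[p k])%:MP = \sum_j (D j \mPo s k) * (d j \mPo s k).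
      rewrite -(comp_mpoly_scale _ _ hg) -comp_s eD (raddf_sum (comp_mpoly (s k))) /=.
      by apply: eq_bigr => j _; rewrite rmorphM.
    rewrite mulr_sumr; under eq_bigr do rewrite mulrCA cramer_s mulr_sumr.
    rewrite exchange_big; apply: eq_bigr => i _ /=.
    rewrite (raddf_sum (comp_mpoly (s k))) mulr_sumr; apply: eq_bigr => j _ /=.
    move: (cofactor _ _ _) => C.
    by rewrite rmorphM /= mulrA [RHS]mulrC.
  have l5 : ell ^+ 5 != 0 by rewrite expf_neq0.
  apply: (mulfI l5); rewrite mulrA -hE mulrDr !mulr_sumr mulr_suml.
  under [X in _ = X + _]eq_bigr do rewrite mulrCA -(hb _).2 mulr_sumr.
  rewrite exchange_big -big_split; apply: eq_bigr => k _ /=.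
  under eq_bigr do rewrite -scalerAr.
  rewrite -scaler_sumr -idk -scalerAl -mul_mpolyC -[in RHS]scalerAr -scalerA.
  by rewrite -scalerDr -[(g.@[p k] *: _)]mul_mpolyC mul_mpolyC; congr (_ *: _); ring.
move=> q.
have : (ell ^+ 5 * h).@[p q] = h.@[p q].
  by rewrite mevalM rmorphXn /= meval_lform ap expr1n mul1r.
(* At x = p_q the term k = q is a diagonal value, where difference quotients become partial
   derivatives; the other terms vanish. *)
move=> <-; rewrite -hE (raddf_sum (meval (p q))) (bigD1 q) //= big1 ?addr0 => [|k kq].
  rewrite mevalZ; congr (_ * _); rewrite comp_mpoly_meval.
  rewrite (@meval_eq _ _ _ (diag (p q))) => [|i]; last first.
    rewrite tnth_mktuple /diag; case: fintype.split => j; rewrite tnth_mktuple ?mevalXU //.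
    by rewrite mevalM mevalC meval_lform ap mul1r.
  rewrite -det_map_mx; congr (\det _); apply/matrixP => i j; rewrite !mxE.
  exact: diff_quotient_diag (hth i).2.
rewrite mevalZ; apply/eqP; rewrite mulf_eq0; apply/orP; right.
(* Cramer's rule at x = p_q has right-hand side zero, as the cubics vanish there, while the factor
   (p_q - p_k)_j is nonzero for some j. *)
have [j pj] : exists j, p q j != p k j.
  apply: contrapT => /forallNP pq; case/eqP: kq; apply/esym/p_inj => j.
  by have /negP := pq j; rewrite negbK => /eqP.
have : (del \mPo s k).@[p q] * (d j \mPo s k).@[p q] = 0.
  rewrite -mevalM cramer_s raddf_sum big1 // => i _.
  by rewrite /= mevalM fp mulr0.
rewrite comp_mpolyB !comp_mpolyXU -!tnth_nth tnth_spec_l tnth_spec_r !tnth_mktuple.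
rewrite mevalB mevalM mevalC mevalXU meval_lform ap mul1r => /eqP.
by rewrite mulf_eq0 subr_eq0 (negPf pj) orbF.
Qed.
End Bezoutian.

(** * Planes transversal to the surface *)

Section CompMap.
Variables (K : fieldType) (n k c d : nat) (t : n.+1.-tuple {mpoly K[k.+1]}).

Definition hcomp (g : dhomog n.+1 K d) : dhomog k.+1 K c :=
  DHomog (pihomogP mdeg c (val g \mPo t)).

Fact hcomp_is_linear : linear hcomp.
Proof. by move=> a x y; apply/val_inj; rewrite /= comp_mpolyD comp_mpolyZ linearP. Qed.
HB.instance Definition _ := GRing.isLinear.Build K _ _ _ hcomp hcomp_is_linear.

Lemma hcompE e g : (forall i, tnth t i \is e.-homog) -> (e * d)%N = c ->
  val (hcomp g) = val g \mPo t.
Proof.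
by move=> ht ec; rewrite /= pihomog_dE // -ec; apply: comp_dhomog; rewrite ?dhomog_is_dhomog.
Qed.
End CompMap.
Arguments hcomp {K n k} c d t.

(** Clears the denominator 3!, so that comparing dimensions becomes a polynomial inequality. *)
Lemma bin_addn3 n : ('C(n + 3, n) * 6 = (n + 3) * (n + 2) * (n + 1))%N.
Proof.
have -> : 'C(n + 3, n) = 'C(n + 3, 3) by rewrite -bin_sub ?leq_addr // addKn.
rewrite (_ : 6%N = 3`!) // bin_ffact !ffactnS ffactn0 muln1 mulnA.
by rewrite !addnS addn0.
Qed.

(* The hypersurface P = 0 contains the dual variety of F = 0. *)
Lemma dual_relation (K : fieldType) (F : {mpoly K[4]}) : F \is 4.-homog -> F != 0 ->
  exists n (P Q : {mpoly K[4]}), [/\ P != 0, P \is n.-homog &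
    P \mPo [tuple F^`M(i) | i < 4] = F * Q].
Proof.
move=> hF F0; set t := [tuple _ | i < 4].
have ht i : tnth t i \is 3.-homog by rewrite tnth_mktuple mderiv_dhomog.
(* The count below amounts to (n + 1)(n + 2)(n + 3) > 108 n^2 + 12, which first holds at n = 102; d
   makes F times a form of degree d have degree 3 n. *)
have [n [d [hn hd]]] : exists n d, (102 <= n)%N /\ (3 * n = 4 + d)%N by exists 102, 302.
pose A := linfun (hcomp (4 + d) n t : dhomog 4 K n -> dhomog 4 K (4 + d)).
pose B := linfun (hmul (4 + d) d F : dhomog 4 K d -> dhomog 4 K (4 + d)).
have AE (g : dhomog 4 K n) : val (A g) = val g \mPo t.
  by rewrite lfunE; exact: hcompE ht hd.
have dB : \dim (limg B) = 'C(d + 3, d) by exact: dim_hmul hF _ F0.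
(* If the partial derivatives satisfy a relation of degree n, it serves as P, with Q = 0. *)
have [kA|kA] := eqVneq (lker A) 0%VS; last first.
  exists n, (val (vpick (lker A))), 0; split; last 1 first.
  - rewrite mulr0 -AE.
    by have := memv_pick (lker A); rewrite memv_ker => /eqP ->.
  - by apply: contra_neq kA => /(@val_inj _ _ _ _ 0)/eqP; rewrite vpick0 => /eqP.
  exact: dhomog_is_dhomog.
have dA : \dim (limg A) = 'C(n + 3, n).
  by rewrite limg_dim_eq ?dim_dhomog // kA capv0.
(* Otherwise the dimensions of the two images add up to more than that of the forms of degree 4 + d,
   and a common element gives P and Q. *)
have cap0 : (limg A :&: limg B)%VS != 0%VS.
  rewrite -dimv_eq0; have := dimv_sum_cap (limg A) (limg B).
  have := dimvS (subvf (limg A + limg B)%VS); rewrite dim_dhomog dA dB.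
  have := bin_addn3 n; have := bin_addn3 d; have := bin_addn3 (4 + d).
  move: 'C(4 + d + 3, 4 + d) 'C(d + 3, d) 'C(n + 3, n) (\dim _) (\dim _) => c1 c2 c3 s1 s2.
  move=> e1 e2 e3 le1 e4; apply/negP => /eqP z.
  have : (6 * c3 + 6 * c2 <= 6 * c1)%N by lia.
  rewrite -![(6 * _)%N]mulnC ![(_ * 6)%N]mulnC; move: e1 e2 e3; clear -hn hd.
  nia.
have := memv_pick (limg A :&: limg B)%VS; rewrite memv_cap => /andP[/memv_imgP [P _ PE]].
move=> /memv_imgP [Q _ QE].
exists n, (val P), (val Q); split; last 1 first.
- rewrite -AE -PE QE lfunE; exact: hmulE hF _.
- apply: contra_neq cap0 => /(@val_inj _ _ _ P 0) P0.
  by apply/eqP; rewrite -vpick0 PE P0 linear0.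
exact: dhomog_is_dhomog.
Qed.

(** Take a off the zeros of X_0, of P and of the linear forms dual to the p_k. If the gradient at a
    point x of the surface is c a, then c^n P(a) = F(x) Q(x) = 0, which forces c = 0. *)
Lemma generic_plane (K : numFieldType) (F : {mpoly K[4]}) m (p : 'I_m -> 'I_4 -> K) :
  F \is 4.-homog -> F != 0 -> (forall k, exists i, p k i != 0) ->
  exists a : 'I_4 -> K, [/\ a 0 != 0, forall k, \sum_i a i * p k i != 0 &
    forall x c, F.@[x] = 0 -> (forall i, (F^`M(i)).@[x] = c * a i) -> c = 0].
Proof.
move=> hF F0 hp; have [n [P [Q [P0 hP PQ]]]] := dual_relation hF F0.
have : 'X_0 * P * \prod_k lform (p k) != 0.
  rewrite !mulf_neq0 //; first by rewrite -msize_poly_eq0 msizeX.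
  apply/prodf_neq0 => k _; have [i pi] := hp k.
  apply: contraNneq pi => /(congr1 (mcoeff U_(i))).
  rewrite mcoeff0 raddf_sum /= (bigD1 i) //= mcoeffZ mcoeffX eqxx mulr1 big1 ?addr0 => [->//|j ji].
  by rewrite mcoeffZ mcoeffXU (negPf ji) mulr0.
move=> /mpoly_neq0_meval [a]; rewrite !mevalM mevalXU rmorph_prod !mulf_eq0 !negb_or.
case/andP => /andP[a0 Pa] /prodf_neq0 pa.
exists a; split=> // [k|x c Fx gx].
  have := pa k isT; rewrite /= meval_lform.
  by under eq_bigr do rewrite mulrC.
apply/eqP; apply: contraNT Pa => c0.
have := congr1 (meval x) PQ; rewrite mevalM Fx mul0r comp_mpoly_meval.
rewrite (@meval_eq _ _ _ (fun i => c * a i)) => [|i]; last by rewrite tnth_mktuple gx.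
by rewrite (meval_scale _ _ hP) => /eqP; rewrite mulf_eq0 expf_eq0 (negPf c0) andbF.
Qed.

Lemma euler_meval (K : comNzRingType) n d (p : {mpoly K[n]}) (v : 'I_n -> K) :
  p \is d.-homog -> \sum_i v i * (p^`M(i)).@[v] = p.@[v] *+ d.
Proof.
move=> hp; rewrite -mevalMn -(euler hp) raddf_sum /=; apply: eq_bigr => i _.
by rewrite mevalM mevalXU.
Qed.

Lemma mderiv_lform (K : comNzRingType) n (a : 'I_n -> K) j : (lform a)^`M(j) = (a j)%:MP.
Proof.
rewrite raddf_sum (bigD1 j) //= big1 ?addr0 => [|i ij].
  rewrite mderivZ mderivX mnm1E eqxx scale1r -mul_mpolyC.
  rewrite (_ : (_ - _)%MM = 0%MM) ?mpolyX0 ?mulr1 //.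
  by apply/mnmP => l; rewrite !mnmE subnn.
by rewrite mderivZ mderivX mnm1E (negPf ij) scale0r scaler0.
Qed.

(** * Independence of the evaluations at the nodes *)

Section Independence.
Variables (K : numClosedFieldType) (F : {mpoly K[4]}) (m : nat) (v : 'I_m -> 'I_4 -> K).
Hypothesis hF : F \is 4.-homog.
Hypothesis F_neq0 : F != 0.
Hypothesis m16 : (m <= 16)%N.
Hypothesis v_neq0 : forall k, exists i, v k i != 0.
Hypothesis v_sing : forall k i, (F^`M(i)).@[v k] = 0.
Hypothesis v_inj : forall k k' c, (forall i, v k i = c * v k' i) -> k = k'.
Hypothesis v_node : forall k w,
  (forall i, \sum_j (F^`M(i)^`M(j)).@[v k] * w j = 0) -> exists c, forall i, w i = c * v k i.
Hypothesis v_all : forall x, (exists i, x i != 0) ->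
  (forall i, (F^`M(i)).@[x] = 0) -> exists k c, forall i, x i = c * v k i.

Lemma nodes_independent (c : 'I_m -> K) :
  (forall G, G \is 4.-homog -> \sum_k c k * G.@[v k] = 0) -> forall k, c k = 0.
Proof.
move=> c4 q; apply/eqP; apply: contrapT => /negP cq.
have [a [a0 av a_dual]] := generic_plane hF F_neq0 v_neq0.
have hdF i : F^`M(i) \is 3.-homog by exact: mderiv_dhomog.
(* The representatives are rescaled to a(p_k) = 1; the fourth power in [c'] compensates on quartic
   forms. *)
pose al k := \sum_i a i * v k i.
pose p k i := (al k)^-1 * v k i.
pose c' k := c k * al k ^+ 4.
(* Derivatives of F along a basis of the plane a = 0, which has this form because a_0 is nonzero.
   They all vanish exactly where the gradient is proportional to a. *)
pose f (i : 'I_3) := a 0 *: F^`M(lift ord0 i) - a (lift ord0 i) *: F^`M(0).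
have hf i : f i \is 3.-homog by rewrite rpredB ?rpredZ.
have prop (y : 'I_4 -> K) :
    (forall i : 'I_3, a 0 * y (lift ord0 i) = a (lift ord0 i) * y 0) ->
    forall i, y i = y 0 / a 0 * a i.
  move=> ya i; case: (unliftP ord0 i) => [j|] ->; last by rewrite mulfVK.
  by apply: (mulfI a0); rewrite ya; field.
have dp k i : (F^`M(i)).@[p k] = 0 by rewrite (meval_scale _ _ (hdF i)) v_sing mulr0.
have fp i k : (f i).@[p k] = 0 by rewrite mevalB !mevalZ !dp !mulr0 subrr.
have ap k : \sum_i a i * p k i = 1.
  by under eq_bigr do rewrite mulrCA; rewrite -mulr_sumr mulVf ?av.
have c'4 G : G \is 4.-homog -> \sum_k c' k * G.@[p k] = 0.
  move=> hG; rewrite -[RHS](c4 G hG); apply: eq_bigr => k _.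
  by rewrite (meval_scale _ _ hG) exprVn -mulrA mulVKf ?expf_neq0 ?av.
have p_inj k k' : p k =1 p k' -> k = k'.
  move=> pk; apply: (@v_inj _ _ (al k / al k')) => i.
  by have := pk i; rewrite /p -mulrA => <-; rewrite mulVKf // av.
have l0 : lform a != 0.
  by apply/eqP => /(congr1 (meval (p q))); rewrite meval_lform ap meval0; apply/eqP/oner_neq0.
have [h [U [hh hU hg hdet]]] := bezoutian hf fp ap c'4 l0 p_inj.
apply: (count_contradiction (a := a) hf _ hh _ m16 hU hg).
  (* At a common zero with a(x) = 0 the gradient is a multiple of a, so F(x) = 0 by Euler's
     identity. By the choice of a the multiple is zero, so x is a node, yet no node lies on the
     plane. *)
  move=> x x0 ax; apply: contrapT => /forallNP fx.
  have gx i : (F^`M(i)).@[x] = (F^`M(0)).@[x] / a 0 * a i.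
    apply: (prop (fun i => (F^`M(i)).@[x])) => j; apply/eqP; rewrite -subr_eq0.
    by have /negP := fx j; rewrite negbK mevalB !mevalZ.
  have Fx : F.@[x] = 0.
    have := euler_meval x hF; rewrite (_ : \sum_i _ = 0) => [/esym/eqP|].
      by rewrite mulrn_eq0 => /eqP.
    transitivity ((F^`M(0)).@[x] / a 0 * \sum_i a i * x i); last by rewrite ax mulr0.
    by rewrite mulr_sumr; apply: eq_bigr => i _; rewrite [in LHS](gx i); ring.
  have l := a_dual x _ Fx gx.
  have [|k [s xs]] := v_all x0; first by move=> i; rewrite gx l mul0r.
  have : s * al k = 0.
    by rewrite -ax mulr_sumr; apply: eq_bigr => i _; rewrite xs mulrCA.
  move/eqP; rewrite mulf_eq0 (negPf (av k)) orbF => /eqP s0.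
  by case: x0 => i; rewrite xs s0 mul0r eqxx.
suff : h.@[p q] != 0 by apply: contraNneq => ->; rewrite meval0.
rewrite hdet mulf_neq0 ?mulf_neq0 ?expf_neq0 ?av //.
(* A kernel vector w of the Jacobian lies in the plane a = 0, and the Hessian of F at p_q sends it
   to a multiple of a. *)
rewrite -det_tr; apply/det0P => -[w w0 /rowP wM].
have wE i : \sum_j ((phi f a i)^`M(j)).@[p q] * w 0 j = 0.
  have := wM i; rewrite [RHS]mxE mxE => e; rewrite -[RHS]e.
  by apply: eq_bigr => j _; rewrite !mxE mulrC.
have aw : \sum_j a j * w 0 j = 0.
  rewrite -[RHS](wE ord0); apply: eq_bigr => j _.
  by rewrite /phi unlift_none mderiv_lform mevalC.
pose y i := \sum_j (F^`M(i)^`M(j)).@[p q] * w 0 j.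
have yE i : y i = y 0 / a 0 * a i.
  apply: prop => {}i; have := wE (lift ord0 i).
  rewrite /phi liftK => wEi; apply/eqP; rewrite -subr_eq0 -[X in _ == X]wEi.
  rewrite !mulr_sumr -sumrB; apply/eqP/eq_bigr => j _.
  by rewrite mderivB !mderivZ mevalB !mevalZ; ring.
(* By symmetry of the Hessian and Euler's identity, the image is orthogonal to p_q. As a(p_q) = 1,
   the multiple of a is zero and [v_node] applies. *)
have py : \sum_i p q i * y i = 0.
  transitivity (\sum_j w 0 j * \sum_i p q i * (F^`M(j)^`M(i)).@[p q]).
    under eq_bigr do rewrite mulr_sumr.
    rewrite exchange_big; apply: eq_bigr => j _ /=.
    rewrite mulr_sumr; apply: eq_bigr => i _.
    by rewrite mderiv_comm; ring.
  by apply: big1 => j _; rewrite (euler_meval _ (hdF j)) dp mul0rn mulr0.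
have y0 i : y i = 0.
  rewrite yE; suff -> : y 0 / a 0 = 0 by rewrite mul0r.
  have : y 0 / a 0 * \sum_j a j * p q j = \sum_j p q j * y j.
    by rewrite mulr_sumr; apply: eq_bigr => j _; rewrite [y j]yE; ring.
  by rewrite ap mulr1 py.
have [i|s ws] := v_node (k := q) (w := w 0).
  have := y0 i; rewrite /y.
  have hH j : F^`M(i)^`M(j) \is 2.-homog by do 2! apply: mderiv_dhomog.
  under eq_bigr do rewrite (meval_scale _ _ (hH _)) -mulrA.
  by rewrite -mulr_sumr => /eqP; rewrite mulf_eq0 expf_eq0 invr_eq0 (negPf (av q)) => /eqP.
have : s * al q = 0.
  by rewrite -aw mulr_sumr; apply: eq_bigr => i _; rewrite ws mulrCA.
move/eqP; rewrite mulf_eq0 (negPf (av q)) orbF => /eqP s0.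
by case/eqP: w0; apply/rowP => i; rewrite ws s0 mul0r mxE.
Qed.
End Independence.

(** * Affine charts *)

Section Charts.
Variable K : numClosedFieldType.
Variable S : quartic_surface K.
Local Notation P3 := 'PP('rV[K]_4).
Let F := equation S.

Lemma equation_dhomog : F \is 4.-homog. Proof. exact: dhomog_is_dhomog. Qed.

Lemma equation_neq0 : F != 0.
Proof. by apply: contra_neq (hcoord_neq0 S) => /(@val_inj _ _ _ _ 0). Qed.

Lemma mderiv_dehomog (G : {mpoly K[4]}) i k :
  (dehomog i G)^`M(k) = dehomog i (G^`M(lift i k)).
Proof.
rewrite /dehomog mderiv_comp (bigD1 (lift i k)) //= big1 ?addr0 => [|j].
  rewrite tnth_mktuple liftK mderivX mnm1E eqxx scale1r.
  rewrite (_ : (_ - _)%MM = 0%MM) ?mpolyX0 ?mulr1 //.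
  by apply/mnmP => l; rewrite !mnmE subnn.
rewrite tnth_mktuple; case: unliftP => [l ->|_ _]; last by rewrite -mpolyC1 mderivC mulr0.
rewrite (inj_eq (@lift_inj _ _)) mderivX mnm1E => /negPf ->.
by rewrite scale0r mulr0.
Qed.

Lemma meval_dehomog d (G : {mpoly K[4]}) i (p : P3) : G \is d.-homog -> in_chart i p ->
  (dehomog i G).@[chart_coord i p] = (hcoord p 0 i)^-1 ^+ d * G.@[hcoord p 0].
Proof.
move=> hG pi; rewrite -(meval_scale _ _ hG) comp_mpoly_meval; apply: meval_eq => j.
rewrite tnth_mktuple; case: unliftP => [l ->|->]; first by rewrite mevalXU mulrC.
by rewrite meval1 mulVf.
Qed.

(** A chart sees F and three of its partial derivatives; Euler's identity recovers the fourth
    derivative, and conversely gives F = 0 from the four derivatives. *)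
Lemma SingP p : Sing S p <-> forall j, (F^`M(j)).@[hcoord p 0] = 0.
Proof.
have hF := equation_dhomog.
have hdF i : F^`M(i) \is 3.-homog by exact: mderiv_dhomog.
split=> [[i pi [F0 dF0]]|dF0].
  have d0 k : (F^`M(lift i k)).@[hcoord p 0] = 0.
    have := dF0 k; rewrite mderiv_dehomog (meval_dehomog (hdF _) pi) => /eqP.
    by rewrite mulf_eq0 expf_eq0 invr_eq0 (negPf pi) andbF => /eqP.
  have e0 : F.@[hcoord p 0] = 0.
    move/eqP: F0; rewrite (meval_dehomog hF pi).
    by rewrite mulf_eq0 expf_eq0 invr_eq0 (negPf pi) andbF => /eqP.
  move=> j; case: (unliftP i j) => [k|] -> //.
  have := euler_meval (hcoord p 0) hF; rewrite e0 mul0rn (bigD1 i) //= big1 ?addr0.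
    by move/eqP; rewrite mulf_eq0 (negPf pi) => /eqP.
  move=> l li; have [k ->|e] := unliftP i l; first by rewrite d0 mulr0.
  by rewrite e eqxx in li.
have [i pi] : exists i, in_chart i p.
  apply: contrapT => /forallNP p0; have := hcoord_neq0 p => /eqP; case.
  apply/rowP => i; rewrite mxE; apply/eqP.
  by have /negP := p0 i; rewrite negbK.
exists i => //; split.
  rewrite (meval_dehomog hF pi); suff -> : F.@[hcoord p 0] = 0 by rewrite mulr0.
  have := euler_meval (hcoord p 0) hF; rewrite big1 => [/esym/eqP|j _]; last by rewrite dF0 mulr0.
  by rewrite mulrn_eq0 => /eqP.
by move=> k; rewrite mderiv_dehomog (meval_dehomog (hdF _) pi) dF0 mulr0.
Qed.

(** Up to a scalar the affine Hessian is the homogeneous one with row and column i deleted. The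
    point itself is in the kernel by Euler's identity; subtracting a multiple of it from w clears
    coordinate i, and the invertible affine Hessian kills the rest. *)
Lemma node_hessian p w : Sing S p -> nodes S p ->
  (forall i, \sum_j (F^`M(i)^`M(j)).@[hcoord p 0] * w j = 0) ->
  exists c, forall i, w i = c * hcoord p 0 i.
Proof.
move=> /SingP dF [i pi [_ hu]] Hw.
have hF := equation_dhomog.
have hH j k : F^`M(j)^`M(k) \is 2.-homog by do 2! apply: mderiv_dhomog.
set v := hcoord p 0.
have HE j k : hessian (dehomog i F) (chart_coord i p) j k =
    (v i)^-1 ^+ 2 * (F^`M(lift i j)^`M(lift i k)).@[v].
  by rewrite mxE !mderiv_dehomog (meval_dehomog (hH _ _) pi).
have Hv j : \sum_k (F^`M(j)^`M(k)).@[v] * v k = 0.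
  under eq_bigr do rewrite mulrC.
  by rewrite (euler_meval _ (mderiv_dhomog j hF)) dF mul0rn.
exists (w i / v i).
pose z k := w k - w i / v i * v k.
have zi : z i = 0 by rewrite /z mulfVK ?subrr.
have Hz j : \sum_k (F^`M(j)^`M(k)).@[v] * z k = 0.
  transitivity (\sum_k (F^`M(j)^`M(k)).@[v] * w k
                - w i / v i * \sum_k (F^`M(j)^`M(k)).@[v] * v k).
    rewrite mulr_sumr -sumrB; apply: eq_bigr => k _.
    by rewrite /z mulrBr; congr (_ - _); rewrite mulrCA.
  by rewrite Hw Hv mulr0 subrr.
have : hessian (dehomog i F) (chart_coord i p) *m \col_k z (lift i k) = 0.
  apply/colP => j; rewrite !mxE.
  under eq_bigr do rewrite HE mxE -mulrA.
  have := Hz (lift i j); rewrite (bigD1_ord i) //= zi mulr0 add0r => e.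
  by rewrite -mulr_sumr e mulr0.
move=> /(congr1 (mulmx (invmx (hessian (dehomog i F) (chart_coord i p))))).
rewrite mulmx0 mulKmx // => /colP z0 k; apply/eqP; rewrite -subr_eq0 -/(z k).
by case: (unliftP i k) => [l|] ->; rewrite ?zi //; have := z0 l; rewrite !mxE => ->.
Qed.

Lemma Sing_complete x : (exists i, x i != 0) -> (forall i, (F^`M(i)).@[x] = 0) ->
  exists2 p, Sing S p & exists c, forall i, x i = c * hcoord p 0 i.
Proof.
move=> [i xi] dF; pose r : 'rV[K]_4 := \row_j x j.
have r0 : r != 0 by apply: contraNneq xi => /rowP /(_ i); rewrite !mxE => ->.
have d1 : \dim <[r]>%VS == 1%N by rewrite dim_vline r0.
pose p : P3 := ProjPoint d1.
have rE : r \in <[hcoord p]>%VS by rewrite -pline_hcoord memv_line.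
have [c rc] := vlineP _ _ rE.
have xE j : x j = c * hcoord p 0 j by have /rowP/(_ j) := rc; rewrite !mxE.
exists p; last by exists c.
have c0 : c != 0 by apply: contraNneq xi => c0; rewrite xE c0 mul0r.
apply/SingP => j; have := dF j.
rewrite (@meval_eq _ _ _ (fun j => c * hcoord p 0 j)) //.
rewrite (meval_scale _ _ (mderiv_dhomog j equation_dhomog)) => /eqP.
by rewrite mulf_eq0 expf_eq0 (negPf c0) andbF => /eqP.
Qed.

Lemma hcoord_inj (p q : P3) c : (forall i, hcoord p 0 i = c * hcoord q 0 i) -> p = q.
Proof.
move=> pq; have e : hcoord p = c *: hcoord q by apply/rowP => i; rewrite mxE pq.
apply/val_inj/eqP; rewrite /= eqEdim (eqP (valP p)) (eqP (valP q)) leqnn andbT.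
by rewrite (pline_hcoord p) -memvE e memvZ ?memv_pick.
Qed.
End Charts.

(** * From independent evaluations to the dimension of the space of quartics *)

Lemma dim_common_kernel (K : fieldType) (V : vectType K) m (ev : 'I_m -> {linear V -> K^o}) :
  (forall c : 'I_m -> K, (forall G, \sum_k c k * ev k G = 0) -> forall k, c k = 0) ->
  (\dim (\bigcap_(k < m) lker (linfun (ev k))) + m = \dim {:V})%N.
Proof.
move=> ind; set b := vbasis {:V}.
pose E (G : V) : 'rV[K]_m := \row_k ev k G.
have linE : linear E.
  by move=> c G H; apply/rowP => k; rewrite !mxE linearP.
pose EL : {linear V -> 'rV[K]_m} := HB.pack E (GRing.isLinear.Build _ _ _ _ E linE).
have bE G : G = \sum_i coord b i G *: b`_i by apply: coord_vbasis; exact: memvf.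
have -> : (\bigcap_(k < m) lker (linfun (ev k)) = lker (linfun EL))%VS.
  apply/vspaceP => G; rewrite memv_ker lfunE /=.
  apply/idP/eqP => [/subv_bigcapP GE|/rowP GE].
    apply/rowP => k; rewrite !mxE.
    by have := GE k isT; rewrite -memvE memv_ker lfunE => /eqP.
  rewrite memvE; apply/subv_bigcapP => k _; rewrite -memvE memv_ker lfunE.
  by have := GE k; rewrite !mxE => ->.
have := limg_ker_dim (linfun EL) fullv; rewrite capfv => <-; congr (_ + _)%N.
suff -> : limg (linfun EL) = fullv by rewrite dimvf /dim /= mul1n.
apply/eqP; rewrite eqEsubv subvf /=; apply/subvP => r _.
pose A : 'M[K]_(\dim {:V}, m) := \matrix_(i, k) ev k b`_i.
(* A vector killed by the transpose of [A] is a relation between the functionals on a basis, hence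
   everywhere, so it is zero; the joint evaluation map is therefore surjective. *)
have fullA : row_full A.
  rewrite /row_full -mxrank_tr; apply: inj_row_free => c cA.
  apply/rowP => k; rewrite mxE; apply: (ind (c 0)) => G.
  rewrite [G]bE; under eq_bigr do rewrite linear_sum mulr_sumr.
  rewrite exchange_big big1 // => i _ /=.
  move/rowP: cA => /(_ i); rewrite !mxE => cA.
  under eq_bigr do rewrite linearZ /= mulrCA.
  transitivity (coord b i G * \sum_j c 0 j * A^T j i); last by rewrite cA mulr0.
  by rewrite mulr_sumr; apply: eq_bigr => l _; rewrite !mxE.
have rA : r = r *m pinvmx A *m A by rewrite mulmxKpV // submx_full.
apply/memv_imgP; exists (\sum_i (r *m pinvmx A) 0 i *: b`_i); first exact: memvf.
rewrite (lfunE EL) /=; apply/rowP => k; rewrite [in LHS]rA !mxE linear_sum.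
by apply: eq_bigr => i _; rewrite linearZ !mxE.
Qed.

Local Close Scope ring_scope.

Theorem theorem2p2 (R : realType) (delta : nat) (S : quartic_surface R[i]) :
  1 <= delta <= 16 ->
  nodal_quartics delta S ->
  \dim (H0_ideal (Sing S) 4) = 35 - delta.
Proof.
move=> /andP[_ d16] [cardS nodesS].
have finS : finite_set (Sing S) by apply/finite_setP; exists delta.
have szS := card_fset_set cardS.
rewrite /H0_ideal big_tnth; set s := in_tuple _.
set m := size _ in s *; have m_delta : m = delta by exact: szS.
have sS k : Sing S (tnth s k).
  by have := mem_tnth k s; rewrite in_fset_set // inE.
have ind (c : 'I_m -> R[i]) :
    (forall G, (\sum_k c k * @eval_form R[i] 4 (tnth s k) G = 0)%R) -> forall k, c k = 0%R.
  move=> c0; apply: (@nodes_independent _ (equation S) m (fun k => hcoord (tnth s k) 0%R)).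
  - exact: equation_dhomog.
  - exact: equation_neq0.
  - by rewrite m_delta.
  - move=> k; apply: contrapT => /forallNP v0; have := hcoord_neq0 (tnth s k) => /eqP; case.
    by apply/rowP => i; rewrite mxE; have /negP := v0 i; rewrite negbK => /eqP.
  - by move=> k; apply/SingP/sS.
  - by move=> k k' b /hcoord_inj; apply/tuple_uniqP; exact: fset_uniq.
  - move=> k w; apply: node_hessian (sS k) _; exact/nodesS/sS.
  - move=> x x0 /(Sing_complete x0) [p Sp [b xb]].
    have : p \in s by rewrite in_fset_set // inE.
    by move=> /tnthP [k pk]; exists k, b => i; rewrite -pk.
  - move=> G hG; exact: (c0 (DHomog hG)).
have := dim_common_kernel ind; rewrite dim_dhomog => dimE.
(* 35 is the dimension of the quartic forms in four variables; since [dimE] is additive, the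
   truncated subtraction is exact. *)
by rewrite -m_delta (_ : 35 = 'C(4 + 3, 4)) // -dimE addnK.
Qed.
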